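(* Consider the nonhomogeneous frog model on $\mathbb{Z}$ with frog counts $(X_j)_{j\ge 1}$ and left-step probabilities $(p_j)_{j\ge 0}$. Suppose that $X_j$ has the Poisson distribution with mean $\lambda_j$ for each $j\ge 1$, that $p_j=\frac12+a_j$, and that the sequences $\left(\frac{1}{a_j}\right)$ and $(\lambda_j)$ are both concave. Then the model is transient if and only if $$\sum_{n=1}^{\infty}e^{-\lambda_n\left(\frac{1}{4a_n}-\frac12\right)}=\infty .$$
   Context: The nonhomogeneous frog model on $\mathbb{Z}$ is the following discrete-time system of interacting random walks. At time $0$ there is one active frog at the origin $0$, no frogs at negative integers, and $X_j$ sleeping frogs at $x=j$ for each $j\ge 1$. The $X_j$ are independent random variables with values in $\{0,1,2,\dots\}$, with $\mathbb{P}(X_j\ge 1)>0$ for every $j$, and $X_{j+1}\succeq X_j$ for all $j\ge 1$, where $\succeq$ denotes stochastic dominance (i.e. $\mathbb{P}(X_{j+1}\ge k)\ge \mathbb{P}(X_j\ge k)$ for all $k$). (In the Poisson case these two conditions mean $\lambda_j>0$ and $\lambda_{j+1}\ge\lambda_j$ for all $j\ge 1$.) An active frog performs a nearest-neighbor random walk on $\mathbb{Z}$; a sleeping frog stays put until an active frog lands on its vertex, at which moment all sleeping frogs at that vertex become active and begin their own random walks. Each frog originating at $x=j$ ($j\ge 0$), once active, at each step goes left with probability $p_j$ and right with probability $1-p_j$, where $\frac12<p_j<1$ for all $j\ge 0$ and the sequence $(p_j)_{j\ge 1}$ is decreasing in the weak sense ($p_{j+1}\le p_j$). All random walks are mutually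 independent and independent of the $X_j$. The model is called transient if the probability that infinitely many distinct frogs hit the origin is $0$; otherwise it is non-transient. A sequence $(g(j))_{j\ge 1}$ is concave if $g(j+1)-g(j)$ is non-increasing in $j$. *)

(* Defs.v *)
From HB Require Import structures.
From mathcomp Require Import all_boot all_order all_algebra finmap.
From mathcomp Require Import all_classical all_reals all_analysis.

Set Implicit Arguments.
Unset Strict Implicit.
Unset Printing Implicit Defensive.

Import Order.TTheory GRing.Theory Num.Theory.

Local Open Scope classical_set_scope.
Local Open Scope ring_scope.

Definition mutual_independence d (T : measurableType d) (R : realType)
    (P : probability T R) (I : choiceType) (F : I -> set_system T) : Prop :=
  forall (J : {fset I}) (E : I -> set T),
    (forall i, i \in J -> F i (E i)) ->
    P (\bigcap_(i in [set` J]) E i) = (\prod_(i <- J) P (E i))%E.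

(* One realization of the model: [x j] is the number of sleeping frogs at
   [j >= 1] ([x 0] is not used), and [l j i t] tells whether the frog number
   [i] of site [j] makes its [t]-th step after activation (counted from 0) to
   the left. The steps are given for every [i : nat], but only the frogs with
   [i < frogs x j] exist. *)
Definition frogs (x : nat -> nat) (j : nat) : nat :=
  if j == 0%N then 1%N else x j.

Definition frog_walk (l : nat -> nat -> nat -> bool) (j i t : nat) : int :=
  j%:Z + \sum_(u < t) (if l j i u then -1 else 1).

(* [wake_time x l n j = Some m] iff [m <= n] and the frogs of site [j] become
   active at time [m]; it is [None] if they are asleep at time [n]. *)
Fixpoint wake_time (x : nat -> nat) (l : nat -> nat -> nat -> bool) (n : nat) :
    nat -> option nat :=
  match n with
  | 0%N => fun k => if k == 0%N then Some 0%N else None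
  | n'.+1 => fun k =>
      match wake_time x l n' k with
      | Some m => Some m
      | None =>
          if `[< exists j i m : nat,
                 [/\ (i < frogs x j)%N, wake_time x l n' j = Some m
                   & frog_walk l j i (n'.+1 - m) = k%:Z] >]
          then Some n'.+1 else None
      end
  end.

Definition hits_origin (x : nat -> nat) (l : nat -> nat -> nat -> bool)
    (j i : nat) : Prop :=
  (i < frogs x j)%N /\
  exists n m : nat, wake_time x l n j = Some m /\ frog_walk l j i (n - m) = 0.

Section frog_model.
Context d (T : measurableType d) (R : realType) (P : probability T R).
Variables (X : nat -> {RV P >-> nat})
  (L : nat -> nat -> nat -> {RV P >-> bool}).

(* The sigma-algebras generated by the variables [X_j], [j >= 1], and by the
   individual steps; [X 0] is not part of the model. *)
Definition frog_sigma (v : nat + nat * nat * nat) : set_system T :=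
  match v with
  | inl j => preimage_set_system setT (X j.+1) measurable
  | inr (j, i, t) => preimage_set_system setT (L j i t) measurable
  end.

Record frog_model (p : nat -> R) : Prop := FrogModel {
  frog_count_gt0 : forall j, (1 <= j)%N ->
    (0 < P [set w | (1 <= X j w)%N])%E;
  frog_count_dominance : forall j, (1 <= j)%N ->
    forall k, (P [set w | (k <= X j w)%N] <= P [set w | (k <= X j.+1 w)%N])%E;
  frog_left_prob : forall j, 1 / 2 < p j < 1;
  frog_left_prob_decreasing : forall j, (1 <= j)%N -> p j.+1 <= p j;
  frog_step : forall j i t, P [set w | L j i t w = true] = (p j)%:E;
  frog_independence : mutual_independence P frog_sigma
}.

Definition transient : Prop :=
  P [set w | infinite_set [set f : nat * nat |
      hits_origin (fun j => X j w) (fun j i t => L j i t w) f.1 f.2]] = 0%E.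

End frog_model.

(* For [r > 0]; at [r <= 0] the library's [poisson_pmf] is the constant 1, so
   that no random variable satisfies this. *)
Definition poisson_distributed d (T : measurableType d) (R : realType)
    (P : probability T R) (Y : {RV P >-> nat}) (r : R) : Prop :=
  forall k, P [set w | Y w = k] = (poisson_pmf r k)%:E.

Definition concave_seq (R : realType) (g : nat -> R) : Prop :=
  forall i j, (1 <= i <= j)%N -> g j.+1 - g j <= g i.+1 - g i.

(* Main.v *)
Require Import Defs.
From HB Require Import structures.
From mathcomp Require Import all_boot all_order all_algebra finmap.
From mathcomp Require Import all_classical all_reals all_analysis.
From mathcomp Require Import zify ring lra.

Set Implicit Arguments.
Unset Strict Implicit.
Unset Printing Implicit Defensive.

Import Order.TTheory GRing.Theory Num.Theory.
Import numFieldNormedType.Exports.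

Local Open Scope classical_set_scope.
Local Open Scope ring_scope.

(** Every frog drifts to the left, so it returns to the origin almost surely
once it is awake, and almost surely infinitely many sites carry frogs. The
model is therefore transient exactly when almost surely only finitely many
sites wake up. The waves of activation stop at a site [m] when no frog of the
sites [0], ..., [m] ever passes [m]. Attach its whole walk to every frog, awake
or not, and call [barrier n m] the event that no frog of the sites [n], ...,
[m] passes [m]. By gambler's ruin a frog of site [j] ever advances by [r] with
probability [rho j ^+ r], where [rho j = (1 - p j) / p j]; since the numbers of
frogs are Poisson, [barrier 1 m] has probability [expR (- S m)] with
[S m = \sum_(1 <= j <= m) lambda j * rho j ^+ (m.+1 - j)], which is
[drift_sum]. The first half of the proof shows that the model is transient if
and only if the series of these probabilities diverges.

If it diverges, let [n] be the first index at which [barrier 0 n] occurs. This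
only involves the sites up to [n], and from there on [barrier 0 m] amounts to
[barrier n.+1 m], which is at most as likely as [barrier 1 (m - n)] because
[lambda] and [rho] are nondecreasing ([barrier_prob_shift]). Summing this
renewal decomposition over [m < M] bounds
[\sum_(m < M) P (barrier 0 m)] by [q * \sum_(m < M) P (barrier 1 m)], where [q]
is the probability that some [barrier 0 n] occurs. The two sums differ by a
bounded amount, as the frog of the origin advances by [m.+1] with probability
only [rho 0 ^+ m.+1]; as both diverge with [M], [q = 1]
([divergent_transient]).

If it converges, the Borel-Cantelli lemma gives an [M] such that with positive
probability no [barrier 1 n] with [M <= n] occurs. Independently, the frog of
the origin reaches [M] with positive probability, and then all sites wake up
([convergent_not_transient]).

It remains to compare [S n] with [lambda n * b n], where
[b n = 1 / (4 * a n) - 1 / 2] is the sum of the powers [rho n ^+ k] over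
[1 <= k]. Monotonicity gives [S n <= lambda n * b n]. In the other direction
concavity places [lambda] and [b] above their chords, so that the relative
loss is of order [(b n ^+ 2 + b n) / n] ([drift_sum_ge]). When [b n] is at most
the fourth root of [n], then either the terms [expR (- S n)] and
[expR (- (lambda n * b n))] agree up to a constant factor, or the former is
less than a constant times [n ^- 2]. The latter bound also holds when [b n] is
larger, since it may then be replaced by the fourth root of [n]
([drift_series_oo]). *)

(** * Independence of events in disjoint blocks of variables *)

Section generated_blocks.
Context {T : Type} {I : choiceType}.
Variable F : I -> set_system T.

Definition generated (B : set I) : set_system T :=
  <<s \bigcup_(i in B) F i >>.

Lemma generated_gen (B : set I) i E : B i -> F i E -> generated B E.
Proof.
move=> Bi FE; suff : (\bigcup_(i in B) F i) E by exact: sub_sigma_algebra.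
by exists i.
Qed.

Variable B : set I.

Lemma generated_not (Q : T -> Prop) :
  generated B [set w | Q w] -> generated B [set w | ~ Q w].
Proof.
move=> BQ; have := sigma_algebraCD BQ.
by congr (generated B _); apply/seteqP; split => w //= [].
Qed.

Lemma generated_exists (Q : nat -> T -> Prop) :
  (forall k, generated B [set w | Q k w]) ->
  generated B [set w | exists k, Q k w].
Proof.
move=> BQ; have := sigma_algebra_bigcup BQ.
congr (generated B _); apply/seteqP; split => w /=.
  by move=> [k _ ?]; exists k.
by move=> [k ?]; exists k.
Qed.

Lemma generated_forall (Q : nat -> T -> Prop) :
  (forall k, generated B [set w | Q k w]) ->
  generated B [set w | forall k, Q k w].
Proof.
move=> BQ.
suff -> : [set w | forall k, Q k w] = [set w | ~ exists k, ~ Q k w].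
  by apply: generated_not; apply: generated_exists => k; exact: generated_not.
apply/seteqP; split => w /=; first by move=> Qw [k]; exact.
by move=> nQ k; apply: contrapT => Qk; apply: nQ; exists k.
Qed.

Lemma generated_or (Q Q' : T -> Prop) :
  generated B [set w | Q w] -> generated B [set w | Q' w] ->
  generated B [set w | Q w \/ Q' w].
Proof.
move=> BQ BQ'.
suff -> : [set w | Q w \/ Q' w] =
    [set w | exists k, (if k == 0%N then Q else Q') w].
  by apply: generated_exists => -[].
apply/seteqP; split => w /=; first by case; [exists 0%N|exists 1%N].
by move=> [[|k]] /=; [left|right].
Qed.

Lemma generated_and (Q Q' : T -> Prop) :
  generated B [set w | Q w] -> generated B [set w | Q' w] ->
  generated B [set w | Q w /\ Q' w].
Proof.
move=> BQ BQ'.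
suff -> : [set w | Q w /\ Q' w] =
    [set w | forall k, (if k == 0%N then Q else Q') w].
  by apply: generated_forall => -[].
apply/seteqP; split => w /=; first by move=> [? ?] [].
by move=> QQ'; split; [exact: (QQ' 0%N)|exact: (QQ' 1%N)].
Qed.

Lemma generated_cst (Q : Prop) : generated B [set w | Q].
Proof.
have B0 : generated B [set w | False].
  rewrite (_ : [set _ | _] = set0); first exact: sigma_algebra0.
  by apply/seteqP; split.
have [q|nq] := pselect Q; last first.
  by rewrite (_ : Q = False)//; apply/propext; split.
suff -> : Q = ~ False by exact: generated_not.
rewrite propeqE; split => // _ [].
Qed.

Lemma generated_imply (Q Q' : T -> Prop) :
  generated B [set w | Q w] -> generated B [set w | Q' w] ->
  generated B [set w | Q w -> Q' w].
Proof.
move=> BQ BQ'.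
suff -> : [set w | Q w -> Q' w] = [set w | ~ Q w \/ Q' w].
  by apply: generated_or => //; exact: generated_not.
apply/seteqP; split => w /=; last by case=> // nQ /nQ.
by move=> QQ'; have [/QQ'|] := pselect (Q w); [right|left].
Qed.

Lemma generated_when (c : bool) (Q : T -> Prop) :
  (c -> generated B [set w | Q w]) -> generated B [set w | c -> Q w].
Proof.
move=> cQ; case: c cQ => cQ.
  by apply: generated_imply; [exact: generated_cst|exact: cQ].
rewrite (_ : [set _ | _] = [set w | ~ False]).
  by apply: generated_not; exact: generated_cst.
by apply/seteqP; split => w _ // [].
Qed.

End generated_blocks.

Section block_independence.
Context d (T : measurableType d) (R : realType) (P : probability T R).
Context (I : choiceType) (F : I -> set_system T).
Hypothesis F_sigma : forall i, sigma_algebra setT (F i).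
Hypothesis F_meas : forall i, F i `<=` measurable.
Hypothesis F_indep : mutual_independence P F.

Lemma generated_measurable (B : set I) E : generated F B E -> measurable E.
Proof.
apply: smallest_sub; first exact: sigma_algebra_measurable.
by move=> A [i _]; exact: F_meas.
Qed.

Definition cylinder (B : set I) : set_system T :=
  [set E | exists (J : {fset I}) (f : I -> set T),
    [/\ forall i, i \in J -> B i, forall i, i \in J -> F i (f i) &
        E = \bigcap_(i in [set` J]) f i]].

Let F_T i : F i setT.
Proof.
by have [F0 FC _] := F_sigma i; rewrite -[setT]setD0; exact: FC.
Qed.

Let F_I i A B : F i A -> F i B -> F i (A `&` B).
Proof.
move=> FA FB; pose T' : measurableType _ := g_sigma_algebraType (F i).
have FE : @measurable _ T' = F i by exact: sigma_algebra_id.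
by move: FA FB; rewrite -FE => FA FB; exact: measurableI.
Qed.

Lemma cylinder_setI (B : set I) : setI_closed (cylinder B).
Proof.
move=> _ _ [J [f [JB Ff ->]]] [J' [f' [JB' Ff' ->]]].
exists (J `|` J')%fset; exists (fun i =>
  (if i \in J then f i else setT) `&` (if i \in J' then f' i else setT)).
split => [i|i _|].
- by rewrite in_fsetU => /orP[/JB|/JB'].
- by apply: F_I; case: ifPn => // ?; [exact: Ff|exact: Ff'].
apply/seteqP; split => w /=.
  move=> [fw f'w] i _ /=; split; case: ifPn => //; first exact: fw.
  exact: f'w.
move=> fw; split => i /= iJ.
  by have := fw i; rewrite /= in_fsetU iJ => /(_ isT) [].
by have := fw i; rewrite /= in_fsetU iJ orbT => /(_ isT) [].
Qed.

Lemma cylinder_setT (B : set I) : cylinder B setT.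
Proof.
exists fset0, (fun=> setT); split => //.
by apply/seteqP; split.
Qed.

Lemma cylinder_measurable (B : set I) E : cylinder B E -> measurable E.
Proof.
move=> [J [f [_ Ff ->]]]; apply: fin_bigcap_measurable => [|i /= iJ].
  exact: finite_fset.
exact/F_meas/Ff.
Qed.

Lemma generatedE (B : set I) : generated F B = <<s cylinder B >>.
Proof.
apply/seteqP; split; last first.
  apply: smallest_sub; first exact: smallest_sigma_algebra.
  move=> _ [J [f [JB Ff ->]]].
  apply: (@fin_bigcap_measurable _ (g_sigma_algebraType _)).
    exact: finite_fset.
  by move=> i /= iJ; apply: sub_sigma_algebra; exists i; [exact: JB|exact: Ff].
apply: smallest_sub; first exact: smallest_sigma_algebra.
move=> E [i Bi FE]; apply: sub_sigma_algebra.
exists [fset i]%fset, (fun=> E); split.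
- by move=> k; rewrite in_fset1 => /eqP ->.
- by move=> k; rewrite in_fset1 => /eqP ->.
by apply/seteqP; split => [w Ew k|w /(_ i)] //=; rewrite in_fset1 eqxx; exact.
Qed.

Lemma cylinder_independence (A B : set I) E E' :
  A `&` B = set0 -> cylinder A E -> cylinder B E' ->
  P (E `&` E') = (P E * P E')%E.
Proof.
move=> AB0 [J [f [JA Ff ->]]] [J' [f' [JB Ff' ->]]].
have dJ i : i \in J -> i \in J' -> False.
  move=> /JA Ai /JB Bi.
  by have : (A `&` B) i by []; rewrite AB0.
pose g i := if i \in J then f i else f' i.
have -> : \bigcap_(i in [set` J]) f i `&` \bigcap_(i in [set` J']) f' i =
    \bigcap_(i in [set` (J `|` J')%fset]) g i.
  apply/seteqP; split => w /=.
    move=> [fw f'w] i /=; rewrite in_fsetU /g.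
    by case: ifPn => [iJ _|_ /= ]; [exact: fw|exact: f'w].
  move=> gw; split => i /= iJ; have := gw i; rewrite /= in_fsetU iJ ?orbT /g.
    by rewrite iJ; exact.
  by case: ifPn => [/dJ/(_ iJ)//|_]; exact.
rewrite !F_indep//; last first.
  move=> i; rewrite in_fsetU /g; case: ifPn => [/Ff//|_ /=]; exact: Ff'.
have -> : (\prod_(i <- (J `|` J')%fset) P (g i) =
    \prod_(i <- enum_fset J ++ enum_fset J') P (g i))%E.
  apply: perm_big; apply: uniq_perm; first exact: fset_uniq.
    rewrite cat_uniq !fset_uniq andbT /=; apply/hasPn => i iJ'.
    by apply/negP => iJ; exact: (dJ i).
  by move=> i; rewrite mem_cat; exact: in_fsetU.
rewrite big_cat /=; congr (_ * _)%E.
  by apply: eq_big_seq => i iJ; rewrite /g iJ.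
apply: eq_big_seq => i iJ; rewrite /g; case: ifPn => // /dJ/(_ iJ) //.
Qed.

(** As functions of [E], both sides are finite measures. *)
Lemma independence_extend (G : set_system T) E' :
  G `<=` measurable -> setI_closed G -> G setT -> measurable E' ->
  (forall E, G E -> P (E `&` E') = (P E * P E')%E) ->
  forall E, <<s G >> E -> P (E `&` E') = (P E * P E')%E.
Proof.
move=> Gm GI GT mE' GE' E sGE.
have PE'0 : 0 <= fine (P E') by exact: fine_ge0.
have PE' : P E' = (fine (P E'))%:E by rewrite fineK// fin_num_measure.
rewrite [RHS]muleC.
rewrite [in RHS]PE'.
apply: (@g_sigma_algebra_measure_unique _ _ _ G Gm (fun=> setT) (fun=> GT) _
  (mrestr P mE') (mscale (NngNum PE'0) P)) => //.
- by rewrite bigcup_const//; exists 0%N.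
- by move=> A GA /=; rewrite /mscale /mrestr /= GE'// muleC PE'.
- move=> _; rewrite /= /mrestr setTI.
  by apply: (le_lt_trans (probability_le1 _ mE')); rewrite ltry.
Qed.

(** The finite cylinders form a generating pi-system on either side; the product
rule extends from them to the generated sigma-algebras one side at a time. *)
Lemma block_independence (A B : set I) E E' :
  A `&` B = set0 -> generated F A E -> generated F B E' ->
  P (E `&` E') = (P E * P E')%E.
Proof.
move=> AB0 AE BE'; have mE' := generated_measurable BE'.
move: AE; rewrite generatedE; apply: independence_extend => //.
- exact: cylinder_measurable.
- exact: cylinder_setI.
- exact: cylinder_setT.
move=> {}E AE; have mE := cylinder_measurable AE.
rewrite setIC muleC; move: BE'; rewrite generatedE.
apply: independence_extend => //.
- exact: cylinder_measurable.
- exact: cylinder_setI.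
- exact: cylinder_setT.
by move=> E'' BE''; apply: (cylinder_independence _ BE'' AE); rewrite setIC.
Qed.

End block_independence.

(** * Nearest-neighbor walks and gambler's ruin *)

(** The direction [b] is the one that counts upwards, so that the same analysis
serves for frogs moving right ([false]) and left ([true]). *)
Definition walk (b : bool) (s : nat -> bool) (t : nat) : int :=
  \sum_(u < t) (if s u == b then 1 else -1).

Definition reaches (b : bool) (s : nat -> bool) (r : nat) : Prop :=
  exists t, walk b s t = r%:Z.

Lemma walkS b s t : walk b s t.+1 = walk b s t + (if s t == b then 1 else -1).
Proof. by rewrite /walk big_ord_recr. Qed.

Lemma walk_shift b s t :
  walk b s t.+1 = (if s 0%N == b then 1 else -1) + walk b (fun u => s u.+1) t.
Proof. by rewrite /walk big_ord_recl. Qed.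

Lemma walkN b s t : walk (~~ b) s t = - walk b s t.
Proof.
elim: t => [|t IHt]; first by rewrite /walk !big_ord0 oppr0.
by rewrite !walkS IHt opprD; case: (s t) (b) => [] [].
Qed.

(** Steps have size one, so a walk skips no level. *)
Lemma walk_ge_reaches b s t r : r%:Z <= walk b s t -> reaches b s r.
Proof.
elim: t => [|t IHt].
  rewrite {1}/walk big_ord0 => r0; exists 0%N; rewrite /walk big_ord0.
  by apply/eqP; rewrite eq_le r0.
rewrite walkS => rt; have [/IHt//|tr] := leP r%:Z (walk b s t).
by exists t.+1; rewrite walkS; move: rt tr; case: ifP; lia.
Qed.

Lemma reaches_le b s r r' : (r <= r')%N -> reaches b s r' -> reaches b s r.
Proof.
by move=> rr' [t tr']; apply: (@walk_ge_reaches _ _ t); rewrite tr'; lia.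
Qed.

(** The probability that a walk going up with probability [u] avoids level [r]
during its first [N] steps, by conditioning on the first step. *)
Fixpoint miss (R : realType) (u : R) (N r : nat) : R :=
  match r, N with
  | 0, _ => 0
  | _.+1, 0 => 1
  | r'.+1, N'.+1 => u * miss u N' r' + (1 - u) * miss u N' r'.+2
  end.

Section miss_limit.
Context (R : realType).
Variables (u k : R).
Hypotheses (u01 : 0 < u < 1) (u_half : u != 1 / 2).
Hypotheses (k_ge0 : 0 <= k) (k_fix : k = u + (1 - u) * k ^+ 2).
Hypothesis k_le : k ^+ 2 <= u / (1 - u).

Let mu : R := Num.sqrt (u / (1 - u)).
Let theta : R := 2 * u / mu.

Let u_gt0 : 0 < u. Proof. by case/andP: u01. Qed.

Let v_gt0 : 0 < 1 - u. Proof. by rewrite subr_gt0; case/andP: u01. Qed.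

Let ratio_ge0 : 0 <= u / (1 - u). Proof. by rewrite divr_ge0// ltW. Qed.

Let mu_gt0 : 0 < mu. Proof. by rewrite sqrtr_gt0 divr_gt0. Qed.

Let mu2 : (1 - u) * mu ^+ 2 = u.
Proof. by rewrite sqr_sqrtr// mulrC divfK// gt_eqF. Qed.

Let k_mu : k <= mu.
Proof. by rewrite -(@ler_pXn2r _ 2) ?nnegrE ?(ltW mu_gt0)// sqr_sqrtr. Qed.

Let theta_ge0 : 0 <= theta.
Proof. by rewrite divr_ge0 ?mulr_ge0// ltW. Qed.

(** This is the inequality of arithmetic and geometric means for the two step
probabilities, strict since they differ. *)
Let theta_lt1 : theta < 1.
Proof.
rewrite ltr_pdivrMr// mul1r.
rewrite -(@ltr_pXn2r _ 2)// ?nnegrE ?mulr_ge0 ?(ltW mu_gt0) ?(ltW u_gt0)//.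
have [] := (mu2, u01); set m := mu ^+ 2.
have : 0 < (u - 1 / 2) ^+ 2 by rewrite exprn_even_gt0//= subr_eq0.
nra.
Qed.

(** The square root [mu] of the ratio of the two step probabilities makes
[mu ^+ r] an eigenvector of the walk killed at its target, with eigenvalue
[theta < 1], which dominates the error at time 0. *)
Lemma miss_bounds N r :
  0 <= miss u N r - (1 - k ^+ r) <= theta ^+ N * mu ^+ r.
Proof.
elim: N r => [|N IHN] [|r] /=.
- by rewrite expr0 subrr subr0 mulr1 lexx ler01.
- rewrite expr0 mul1r opprB addrCA subrr addr0 exprn_ge0//=.
  by rewrite lerXn2r// nnegrE// ltW.
- by rewrite expr0 subrr subr0 lexx/= mulr_ge0// ?exprn_ge0// ltW.
have /andP[a0 a1] := IHN r; have /andP[b0 b1] := IHN r.+2.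
have -> : u * miss u N r + (1 - u) * miss u N r.+2 - (1 - k ^+ r.+1) =
    u * (miss u N r - (1 - k ^+ r)) +
    (1 - u) * (miss u N r.+2 - (1 - k ^+ r.+2)).
  by rewrite !exprS {1}k_fix; ring.
apply/andP; split; first by rewrite addr_ge0// mulr_ge0// ltW.
have -> : theta ^+ N.+1 * mu ^+ r.+1 =
    u * (theta ^+ N * mu ^+ r) + (1 - u) * (theta ^+ N * mu ^+ r.+2).
  have -> : mu ^+ r.+2 = mu ^+ r * mu ^+ 2 by rewrite -exprD addn2.
  rewrite [RHS](_ : _ = theta ^+ N * mu ^+ r * (u + (1 - u) * mu ^+ 2)).
    by rewrite mu2 !exprS /theta; field; rewrite gt_eqF.
  by ring.
by rewrite lerD// ler_wpM2l// ltW.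
Qed.

(** Both roots [1] and [u / (1 - u)] solve the fixed-point equation for the
probability [k] of ever climbing one level; the bound on [k ^+ 2] selects the
smaller one. *)
Lemma cvg_miss r : miss u ^~ r @ \oo --> 1 - k ^+ r.
Proof.
apply: (@squeeze_cvgr _ _ _ _ (fun=> 1 - k ^+ r)
  (fun N => 1 - k ^+ r + theta ^+ N * mu ^+ r)).
- apply: nearW => N; have /andP[lo hi] := miss_bounds N r.
  by rewrite -subr_ge0 lo -lerBlDl hi.
- exact: cvg_cst.
rewrite -[X in _ --> X]addr0; apply: cvgD; first exact: cvg_cst.
rewrite -(mul0r (mu ^+ r)); apply: cvgMl.
by apply: cvg_expr; rewrite ger0_norm.
Qed.

End miss_limit.

Section random_walk.
Context d (T : measurableType d) (R : realType) (P : probability T R).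
Context (I : choiceType) (F : I -> set_system T).
Hypothesis F_sigma : forall i, sigma_algebra setT (F i).
Hypothesis F_meas : forall i, F i `<=` measurable.
Hypothesis F_indep : mutual_independence P F.
Variables (idx : nat -> I) (s : nat -> T -> bool).
Hypothesis s_sigma : forall t b, F (idx t) [set w | s t w = b].

Lemma generated_step (B : set I) t b (Bt : B (idx t)) :
  generated F B [set w | s t w == b].
Proof.
rewrite (_ : [set _ | _] = [set w | s t w = b]).
  exact: generated_gen (s_sigma t b).
by apply/seteqP; split => w /eqP.
Qed.

Lemma generated_walk (B : set I) b n t z :
  (forall v, B (idx (n + v))) ->
  generated F B [set w | walk b (fun v => s (n + v) w) t = z].
Proof.
move=> Bidx; elim: t z => [|t IHt] z.
  by rewrite /walk; under eq_set do rewrite big_ord0; exact: generated_cst.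
rewrite (_ : [set _ | _] = [set w |
    s (n + t) w == b /\ walk b (fun v => s (n + v) w) t = z - 1 \/
    ~ s (n + t) w == b /\ walk b (fun v => s (n + v) w) t = z + 1]).
  apply: generated_or; apply: generated_and => //.
    exact: generated_step.
  by apply: generated_not; exact: generated_step.
apply/seteqP; split => w /=; rewrite walkS; case: ifP => _.
- by left; split => //; lia.
- by right; split => //; lia.
- by case=> -[] //; lia.
- by case=> -[] //; lia.
Qed.

Lemma generated_reaches (B : set I) b n r : (forall v, B (idx (n + v))) ->
  generated F B [set w | reaches b (fun v => s (n + v) w) r].
Proof.
by move=> Bidx; apply: generated_exists => t; exact: generated_walk.
Qed.

Let avoid b n N r := [set w |
  forall t, (t <= N)%N -> walk b (fun v => s (n + v) w) t <> r%:Z].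

Let generated_avoid (B : set I) b n N r : (forall v, B (idx (n + v))) ->
  generated F B (avoid b n N r).
Proof.
move=> Bidx; apply: generated_forall => t; apply: generated_when => _.
by apply: generated_not; exact: generated_walk.
Qed.

Hypothesis idx_inj : injective idx.
Variables (b : bool) (u : R).
Hypothesis s_law : forall t, P [set w | s t w == b] = u%:E.

Let avoidS n N r : avoid b n N.+1 r.+1 =
  ([set w | s n w == b] `&` avoid b n.+1 N r) `|`
  (~` [set w | s n w == b] `&` avoid b n.+1 N r.+2).
Proof.
have shift w : (fun v => s (n + v.+1) w) = (fun v => s (n.+1 + v) w).
  by apply/funext => v; rewrite addnS.
apply/seteqP; split => w.
  move=> Aw; have [sb|sb] := boolP (s n w == b); [left|right].
    split => // t tN wt; apply: (Aw t.+1) => //.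
    by rewrite walk_shift addn0 sb shift wt; lia.
  split => [|t tN wt]; first by apply/negP.
  apply: (Aw t.+1) => //.
  by rewrite walk_shift addn0 (negPf sb) shift wt; lia.
move=> Aw [_|t tN]; first by rewrite /walk big_ord0.
rewrite walk_shift addn0 shift; case: Aw => -[/= sb Aw].
  by rewrite sb; have := Aw t tN; lia.
by move/negP/negPf: sb => ->; have := Aw t tN; lia.
Qed.

Let probability_avoid n N r : P (avoid b n N r) = (miss u N r)%:E.
Proof.
elim: N n r => [|N IHN] n [|r].
- rewrite (_ : avoid _ _ _ _ = set0) ?measure0//.
  apply/seteqP; split => // w /(_ 0%N isT); rewrite /walk big_ord0; exact.
- rewrite (_ : avoid _ _ _ _ = setT) ?probability_setT//.
  apply/seteqP; split => // w _ t; rewrite leqn0 => /eqP ->.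
  by rewrite /walk big_ord0.
- rewrite (_ : avoid _ _ _ _ = set0) ?measure0//.
  apply/seteqP; split => // w /(_ 0%N isT); rewrite /walk big_ord0; exact.
have disj : [set idx n] `&` [set i | exists v, i = idx (n.+1 + v)%N] = set0.
  by apply/seteqP; split => // i [/= -> [v /idx_inj]]; lia.
have gs : generated F [set idx n] [set w | s n w == b] by exact: generated_step.
have gC : generated F [set idx n] (~` [set w | s n w == b]).
  exact: generated_not.
have gA m : generated F [set i | exists v, i = idx (n.+1 + v)%N]
    (avoid b n.+1 N m).
  by apply: generated_avoid => v; exists v.
have mI A m : generated F [set idx n] A -> measurable (A `&` avoid b n.+1 N m).
  by move=> gs'; apply: measurableI; apply: generated_measurable; eauto.
transitivity (P ([set w | s n w == b] `&` avoid b n.+1 N r) +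
              P (~` [set w | s n w == b] `&` avoid b n.+1 N r.+2))%E.
  rewrite avoidS; apply: measureU; [exact: mI|exact: mI|].
  by rewrite setIACA setICr set0I.
rewrite (block_independence F_sigma F_meas F_indep disj gs (gA r)).
rewrite (block_independence F_sigma F_meas F_indep disj gC (gA r.+2)) !IHN.
rewrite probability_setC; last by apply: generated_measurable; eauto.
by rewrite s_law -EFinB -!EFinM -EFinD.
Qed.

Variable k : R.
Hypotheses (u01 : 0 < u < 1) (u_half : u != 1 / 2).
Hypotheses (k_ge0 : 0 <= k) (k_fix : k = u + (1 - u) * k ^+ 2).
Hypothesis k_le : k ^+ 2 <= u / (1 - u).

(** The walk never reaches [r] if and only if it avoids [r] up to every time
[N]; these events decrease in [N] and have probabilities [miss u N r]. *)
Lemma probability_not_reaches r :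
  P [set w | ~ reaches b (s ^~ w) r] = (1 - k ^+ r)%:E.
Proof.
have -> : [set w | ~ reaches b (s ^~ w) r] = \bigcap_N avoid b 0 N r.
  apply/seteqP; split => w /=.
    by move=> nr N _ t _ wt; apply: nr; exists t.
  by move=> Aw [t wt]; exact: (Aw t Logic.I t (leqnn t) wt).
have mA N : measurable (avoid b 0 N r).
  by apply: (generated_measurable F_meas (B := setT)); exact: generated_avoid.
have : P \o (fun N => avoid b 0 N r) @ \oo --> P (\bigcap_N avoid b 0 N r).
  apply: nonincreasing_cvg_mu => //.
  - by apply: (le_lt_trans (probability_le1 _ (mA 0%N))); rewrite ltry.
  - exact: bigcapT_measurable.
  move=> m n mn; apply/subsetPset => w Aw t tm.
  by apply: Aw; exact: leq_trans mn.
move=> cvP; apply/esym; move: cvP.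
apply: cvg_unique; first exact: ereal_hausdorff.
rewrite (_ : P \o _ = EFin \o (miss u ^~ r)).
  by apply: cvg_EFin; [exact: nearW|exact: cvg_miss].
by apply/funext => N /=; rewrite probability_avoid.
Qed.

End random_walk.

(** * Realizations of the model *)

Lemma infinite_pairsP (S : nat -> nat -> Prop) :
  infinite_set [set f : nat * nat | S f.1 f.2] <->
  forall n, exists j i, (n <= j + i)%N /\ S j i.
Proof.
split => [infS n|nS finS].
  apply: contrapT => nn; apply: infS.
  apply: (@sub_finite_set _ _ (`I_n `*` `I_n)).
    move=> [j i] /= Sji; suff : (j + i < n)%N by move=> ?; split => /=; lia.
    by rewrite ltnNge; apply/negP => nji; apply: nn; exists j, i.
  by apply: finite_setX; exact: finite_II.
have /finite_seqP[s sE] := finS.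
have [j [i [sji Sji]]] := nS (\max_(f <- s) (f.1 + f.2)).+1.
have : (j, i) \in s.
  by move: Sji; rewrite -[S j i]/([set f | S f.1 f.2] (j, i)) sE.
move=> /(@leq_bigmax_seq _ _ xpredT (fun f => f.1 + f.2)%N) - /(_ isT) /=.
by rewrite leqNgt sji.
Qed.

Section realization.
Variables (x : nat -> nat) (l : nat -> nat -> nat -> bool).

Lemma frog_walk_right j i t : frog_walk l j i t = j%:Z + walk false (l j i) t.
Proof.
by congr (_ + _); apply: eq_bigr => u _; case: (l j i u).
Qed.

Lemma frog_walk_left j i t : frog_walk l j i t = j%:Z - walk true (l j i) t.
Proof. by rewrite frog_walk_right (walkN false) opprK. Qed.

Lemma wake_timeS n k : wake_time x l n.+1 k =
  if wake_time x l n k is Some m then Some m else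
  if `[< exists j i m : nat, [/\ (i < frogs x j)%N,
    wake_time x l n j = Some m & frog_walk l j i (n.+1 - m) = k%:Z] >]
  then Some n.+1 else None.
Proof. by []. Qed.

Lemma wake_time_le n k m : wake_time x l n k = Some m -> (m <= n)%N.
Proof.
elim: n m => [|n IHn] m; first by rewrite /=; case: ifP => // _ [<-].
rewrite wake_timeS; case E: (wake_time x l n k) => [m'|].
  by move=> [<-]; apply: leq_trans (IHn _ E) _.
by case: ifP => // _ [<-].
Qed.

Lemma wake_time_self n k m :
  wake_time x l n k = Some m -> wake_time x l m k = Some m.
Proof.
elim: n m => [|n IHn] m wk; first by move: (wk) => /wake_time_le; case: m wk.
move: (wk); rewrite wake_timeS; case E: (wake_time x l n k) => [m'|].
  by move=> [m'm]; apply: IHn; rewrite E m'm.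
by case: ifP => // _ [nm]; rewrite -{1}nm wk.
Qed.

Lemma wake_time_mono n n' k m : (n <= n')%N ->
  wake_time x l n k = Some m -> wake_time x l n' k = Some m.
Proof.
move=> /subnK <-; elim: (n' - n)%N => [//|t IHt] /IHt.
by rewrite addSn wake_timeS => ->.
Qed.

(** Querying [wake_time] at the activation time itself frees the notion from a
horizon. *)
Definition awake k := exists m, wake_time x l m k = Some m.

Lemma awake_walk j i t k : awake j -> (i < frogs x j)%N ->
  frog_walk l j i t = k%:Z -> awake k.
Proof.
move=> [m jm] ij; case: t => [|t] jk.
  move: jk; rewrite frog_walk_right /walk big_ord0 addr0 => -[<-].
  by exists m.
have : wake_time x l (m + t).+1 k <> None.
  rewrite wake_timeS; case: (wake_time x l (m + t) k) => //.
  case: asboolP => // -[]; exists j, i, m; split => //.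
    by apply: wake_time_mono jm; exact: leq_addr.
  by rewrite -addnS addKn.
case E: (wake_time x l (m + t).+1 k) => [m'|] // _.
by exists m'; exact: wake_time_self E.
Qed.

(** The steps of a frog are considered whether or not it ever wakes up, which
makes the blocking events of different sites independent. *)
Definition blocked j r :=
  forall i, (i < frogs x j)%N -> ~ reaches false (l j i) r.

Definition barrier n m :=
  forall j, (n <= j)%N -> (j <= m)%N -> blocked j (m.+1 - j).

(** The sites up to [M] are woken by the frog of the origin. Inductively, a
later site [n.+1] is reached by a frog from a site between [1] and [n], which
is already awake. *)
Lemma all_awake M : reaches false (l 0 0) M ->
  (forall n, (M <= n)%N -> ~ barrier 1 n) -> forall k, awake k.
Proof.
move=> reach0 nb.
have awake0 : awake 0 by exists 0%N.
elim/ltn_ind => k IHk; have [kM|Mk] := leqP k M.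
  have [t tk] := reaches_le kM reach0.
  apply: (@awake_walk 0 0 t) => //.
  by rewrite frog_walk_right tk add0r.
case: k IHk Mk => // n IHn Mn; apply: contrapT => nn; apply: (nb n Mn).
move=> j j1 jn i ij [t tr]; apply: nn.
apply: (@awake_walk j i t) => //; first exact: IHn.
by rewrite frog_walk_right tr; lia.
Qed.

Lemma awake_hits_origin j i : awake j -> (i < frogs x j)%N ->
  reaches true (l j i) j -> hits_origin x l j i.
Proof.
move=> [m jm] ij [t tj]; split => //; exists (m + t)%N, m; split.
  by apply: wake_time_mono jm; exact: leq_addr.
by rewrite addKn frog_walk_left tj subrr.
Qed.

(** The first site beyond [n] to wake up would have to be reached from a site at
most [n], by a frog passing [n]. *)
Lemma barrier_asleep n N k : barrier 0 n -> (n < k)%N ->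
  wake_time x l N k = None.
Proof.
move=> bar; elim: N k => [|N IHN] k nk; first by case: k nk.
rewrite wake_timeS IHN//; case: asboolP => // -[j [i [m [ij jm jk]]]].
have jn : (j <= n)%N by rewrite leqNgt; apply/negP => /IHN; rewrite jm.
case: (bar j (leq0n _) jn i ij); apply: (@walk_ge_reaches _ _ (N.+1 - m)).
by move: jk; rewrite frog_walk_right; lia.
Qed.

Lemma barrier_finite n : barrier 0 n ->
  finite_set [set f : nat * nat | hits_origin x l f.1 f.2].
Proof.
move=> bar; pose most := (\max_(j < n.+1) frogs x j)%N.
apply: (@sub_finite_set _ _ (`I_n.+1 `*` `I_most)).
  move=> [j i] /= [ij [N [m [jm _]]]].
  have jn : (j < n.+1)%N.
    by rewrite ltnNge; apply/negP => /barrier_asleep - /(_ N bar); rewrite jm.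
  split => //=; apply: leq_trans ij _.
  exact: (leq_bigmax (Ordinal jn)).
by apply: finite_setX; exact: finite_II.
Qed.

End realization.

(** * Comparing the two series *)

Lemma nondecreasing_from1 (R : realType) (g : nat -> R) :
  (forall k, (1 <= k)%N -> g k <= g k.+1) ->
  forall i j, (1 <= i <= j)%N -> g i <= g j.
Proof.
move=> gS i j /andP[i1 /subnK <-]; elim: (j - i)%N => [//|n IHn].
by apply: le_trans IHn _; apply: gS; exact: leq_trans i1 (leq_addl n i).
Qed.

Section drift_sums.
Context (R : realType).
Variables (lam b : nat -> R).

Definition drift_sum (n : nat) : R :=
  \sum_(1 <= j < n.+1) lam j * (b j / (1 + b j)) ^+ (n.+1 - j).

Hypotheses (lam_gt0 : forall j, (1 <= j)%N -> 0 < lam j)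
  (b_gt0 : forall j, (1 <= j)%N -> 0 < b j).

Lemma ratio_le (x y : R) : 0 < x -> x <= y -> x / (1 + x) <= y / (1 + y).
Proof.
move=> x0 xy; rewrite ler_pdivrMr; last lra.
rewrite mulrAC ler_pdivlMr; last lra.
by rewrite !mulrDr !mulr1 (mulrC y x) lerD2r.
Qed.

Lemma drift_sum_ge0 n : 0 <= drift_sum n.
Proof.
rewrite /drift_sum big_nat; apply: sumr_ge0 => j /andP[j0 _].
have := b_gt0 j0; have := lam_gt0 j0 => l0 bj.
by rewrite mulr_ge0 ?exprn_ge0 ?divr_ge0//; lra.
Qed.

(** Here [x] is the sum of the infinite series, and what is subtracted is its
tail. *)
Lemma sum_geometric (x : R) n : 0 < x ->
  \sum_(k < n) (x / (1 + x)) ^+ k.+1 = x - x * (x / (1 + x)) ^+ n.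
Proof.
move=> x0; elim: n => [|n IHn]; first by rewrite big_ord0 expr0; ring.
by rewrite big_ord_recr /= IHn !exprS; field; rewrite gt_eqF//; lra.
Qed.

Lemma sum_succ_rev (n : nat) (f : nat -> R) :
  \sum_(1 <= j < n.+1) f j = \sum_(k < n) f (n - k)%N.
Proof.
rewrite big_add1 /= big_mkord (reindex_inj rev_ord_inj) /=.
by apply: eq_bigr => k _; rewrite subnSK.
Qed.

Section upper.
Hypotheses (lam_nd : forall i j, (1 <= i <= j)%N -> lam i <= lam j)
  (b_nd : forall i j, (1 <= i <= j)%N -> b i <= b j).

Lemma drift_sum_le n : (1 <= n)%N -> drift_sum n <= lam n * b n.
Proof.
move=> n1; have bn := b_gt0 n1; have ln := lam_gt0 n1.
have r0 x : 0 < x -> 0 <= x / (1 + x) :> R.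
  by move=> x0; rewrite divr_ge0//; lra.
apply: (@le_trans _ _ (lam n * \sum_(k < n) (b n / (1 + b n)) ^+ k.+1)).
  rewrite /drift_sum sum_succ_rev mulr_sumr; apply: ler_sum => k _.
  have k1 : (1 <= n - k <= n)%N by have := ltn_ord k; lia.
  have k0 : (1 <= n - k)%N by case/andP: k1.
  have -> : (n.+1 - (n - k) = k.+1)%N by have := ltn_ord k; lia.
  rewrite ler_pM//; [exact/ltW/lam_gt0|by rewrite exprn_ge0// r0// b_gt0| |].
    exact: lam_nd.
  rewrite lerXn2r// ?nnegrE ?r0 ?b_gt0//.
  by apply: ratio_le; [exact: b_gt0|exact: b_nd].
rewrite ler_pM2l// sum_geometric// lerBlDl lerDr mulr_ge0 ?exprn_ge0 ?r0//.
exact: ltW.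
Qed.

End upper.

(** By concavity, [i] times the increment after the first [i] ones is at most
the value already reached, so [g n.+1 / n] is nonincreasing in [n]. *)
Lemma concave_chord (g : nat -> R) (g_gt0 : forall j, (1 <= j)%N -> 0 < g j)
    (gc : concave_seq g) j n : (j <= n)%N ->
  j%:R * g n.+1 <= n%:R * g j.+1.
Proof.
have slope i : i%:R * (g i.+2 - g i.+1) <= g i.+1.
  elim: i => [|i IHi]; first by rewrite mul0r ltW// g_gt0.
  apply: (@le_trans _ _ (i.+1%:R * (g i.+2 - g i.+1))).
    by rewrite ler_wpM2l// gc//; lia.
  by rewrite -natr1 mulrDl mul1r; move: IHi; lra.
elim: n => [|n IHn]; first by rewrite leqn0 => /eqP ->.
rewrite leq_eqVlt => /orP[/eqP -> //|]; rewrite ltnS => jn.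
case: n IHn jn => [|n] IHn jn.
  by move: jn; rewrite leqn0 => /eqP ->; rewrite !mul0r mul1r ltW// g_gt0.
have {}IHn := IHn jn; have n0 : 0 < n.+1%:R :> R by rewrite ltr0n.
have jR : 0 <= j%:R :> R by [].
have step : n.+1%:R * g n.+3 <= n.+2%:R * g n.+2.
  have := slope n.+1; rewrite -[n.+2%:R]natr1.
  by rewrite mulrDl mul1r mulrBr; lra.
rewrite -(ler_pM2l n0) mulrCA.
apply: (le_trans (ler_wpM2l jR step)); rewrite mulrCA.
apply: (le_trans (ler_wpM2l _ IHn)) => //.
by rewrite mulrCA.
Qed.

Lemma bernoulli (x : R) m : 0 <= x <= 1 -> 1 - m%:R * x <= (1 - x) ^+ m.
Proof.
move=> /andP[x0 x1]; elim: m => [|m IHm]; first by rewrite mul0r subr0.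
rewrite exprS -natr1.
have : 0 <= (1 - x) * ((1 - x) ^+ m - (1 - m%:R * x)).
  by rewrite mulr_ge0// subr_ge0.
have : 0 <= m%:R * x * x by rewrite !mulr_ge0.
by move: ((1 - x) ^+ m) (m%:R) => p q; nra.
Qed.

(** The closed form subtracted on the right is the tail of the series; it is
nonpositive once all later terms are, which bounds the partial sums below by
the value of the whole series. *)
Lemma sum_quadratic_geometric (x e : R) n : 0 < x ->
  \sum_(k < n) (1 - e * (k%:R * (k%:R + 2))) * (x / (1 + x)) ^+ k.+1 =
  x - e * (2 * x ^+ 3 + 3 * x ^+ 2) -
  (x / (1 + x)) ^+ n * (x - e * (n%:R * (n%:R + 2) * x
    + 2 * n%:R * x ^+ 2 + 2 * x ^+ 3 + 3 * x ^+ 2)).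
Proof.
move=> x0; elim: n => [|n IHn]; first by rewrite big_ord0 expr0; ring.
rewrite big_ord_recr /= IHn -[n.+1%:R]natr1 (exprS _ n); move: (n%:R) => m.
by move: ((x / (1 + x)) ^+ n) => p; field; rewrite gt_eqF//; lra.
Qed.

Hypotheses (lam_concave : concave_seq lam) (b_concave : concave_seq b).

(** At distance [k] below [n.+1] the chords of [lam] and of [b] are lower by the
factor [1 - k / n]. As [x / (1 + x)] is concave and vanishes at [0], it is lower
by at most the same factor, and it occurs to the power [k.+1]. Bernoulli's
inequality collects the resulting [k.+2] factors. Allowing any [x <= b n.+1]
makes it possible to truncate [b] where it is too large for the error term. *)
Lemma drift_sum_ge n x : (1 <= n)%N -> 0 < x -> x <= b n.+1 ->
  lam n.+1 * (x - (2 * x ^+ 3 + 3 * x ^+ 2) / n%:R) <= drift_sum n.+1.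
Proof.
move=> n1 x0 xb; have nR : 0 < n%:R :> R by rewrite ltr0n.
have ln : 0 < lam n.+1 by exact: lam_gt0.
have s0 : 0 <= x / (1 + x) by rewrite divr_ge0//; lra.
apply: (@le_trans _ _ (lam n.+1 * \sum_(k < n.+1)
   (1 - n%:R^-1 * (k%:R * (k%:R + 2))) * (x / (1 + x)) ^+ k.+1)).
  rewrite ler_pM2l// sum_quadratic_geometric//.
  rewrite (mulrC _ n%:R^-1) lerDl oppr_ge0.
  rewrite pmulr_rle0; last by rewrite exprn_gt0// divr_gt0//; lra.
  rewrite subr_le0 ler_pdivlMl// -natr1.
  have : 0 <= x ^+ 2 by rewrite exprn_ge0// ltW.
  have : 0 <= x ^+ 3 by rewrite exprn_ge0// ltW.
  have : 0 <= n%:R * x by rewrite mulr_ge0// ltW.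
  have : 0 <= n%:R * n%:R * x by rewrite !mulr_ge0// ltW.
  have : 0 <= n%:R * x ^+ 2 by rewrite mulr_ge0// exprn_ge0// ltW.
  by move: (x ^+ 2) (x ^+ 3) => x2 x3; nra.
rewrite /drift_sum sum_succ_rev mulr_sumr; apply: ler_sum => k _.
have kn : (k <= n)%N by rewrite -ltnS.
have -> : (n.+2 - (n.+1 - k) = k.+1)%N by lia.
have -> : (n.+1 - k = (n - k).+1)%N by lia.
set t : R := k%:R / n%:R.
have t01 : 0 <= t <= 1 by rewrite divr_ge0//= ler_pdivrMr// mul1r ler_nat.
have chord (g : nat -> R) : (forall j, (1 <= j)%N -> 0 < g j) ->
    concave_seq g -> (1 - t) * g n.+1 <= g (n - k).+1.
  move=> g0 gc; rewrite -(ler_pM2l nR).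
  apply: le_trans (concave_chord g0 gc (leq_subr k n)).
  by rewrite natrB// mulrA mulrBr mulr1 /t mulrCA divff ?mulr1// gt_eqF.
have chord_b : (1 - t) * x <= b (n - k).+1.
  by apply: le_trans (chord _ b_gt0 b_concave); rewrite ler_wpM2l//; lra.
have bk : 0 < b (n - k).+1 by exact: b_gt0.
have ratio_b : (1 - t) * (x / (1 + x)) <= b (n - k).+1 / (1 + b (n - k).+1).
  rewrite mulrA ler_pdivlMr; last lra.
  rewrite mulrAC ler_pdivrMr; last lra.
  have : 0 <= t * x by rewrite mulr_ge0//; lra.
  by move: (b (n - k).+1) chord_b bk t01 => c; nra.
apply: (@le_trans _ _ (lam n.+1 * ((1 - t) ^+ k.+2 * (x / (1 + x)) ^+ k.+1))).
  rewrite ler_pM2l// ler_wpM2r ?exprn_ge0//.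
  apply: le_trans (bernoulli k.+2 t01); rewrite le_eqVlt; apply/orP; left.
  apply/eqP; rewrite /t -[k.+2%:R]natr1 -[k.+1%:R]natr1.
  by field; rewrite gt_eqF.
rewrite exprS -mulrA -exprMn mulrA (mulrC (lam _)).
apply: ler_pM => //.
- by rewrite mulr_ge0 ?(ltW ln)//; lra.
- by rewrite exprn_ge0// mulr_ge0//; lra.
- exact: chord lam_gt0 lam_concave.
rewrite lerXn2r// nnegrE.
- by rewrite mulr_ge0//; lra.
- by rewrite divr_ge0//; lra.
Qed.

Lemma expRN_quartic (x c : R) : 0 < c -> 1 <= x ->
  expR (- (c * x)) <= (8`!%:R / c ^+ 8) / (x ^+ 4) ^+ 2.
Proof.
move=> c0 x1; have cx : 0 < c * x by rewrite mulr_gt0//; lra.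
have := @expR_ge1Dxn R _ 7 (ltW cx); rewrite expRN => h.
rewrite -exprM invf_ple ?posrE ?expR_gt0//; last first.
  by rewrite !divr_gt0 ?exprn_gt0 ?ltr0n ?fact_gt0//; lra.
rewrite !invf_div mulrA -exprMn (mulrC x c); apply: le_trans h.
by rewrite lerDr ler01.
Qed.

Hypothesis lam_nd : forall i j, (1 <= i <= j)%N -> lam i <= lam j.

(** Truncating [b n.+1] at the fourth root [y] of [n] keeps the relative loss in
[drift_sum_ge] at most [5 / y ^+ 2]. If [b n.+1 <= y] and
[lam n.+1 * b n.+1 <= y ^+ 2], the absolute loss is at most [5]. Otherwise the
drift sum is at least a constant multiple of [y - 5], and the exponential of its
opposite is dominated by a multiple of [y ^- 8 = n ^- 2]. *)
Lemma expRN_drift_sum_le n : (1 <= n)%N ->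
  expR (- drift_sum n.+1) <= expR 5 * expR (- (lam n.+1 * b n.+1)) +
    (expR 5 * 8`!%:R + expR (5 * lam 1) * (8`!%:R / lam 1 ^+ 8)) / n%:R ^+ 2.
Proof.
move=> n1; have nR : 1 <= n%:R :> R by rewrite ler1n.
pose y : R := Num.sqrt (Num.sqrt n%:R).
have sqrt_ge1 (x : R) : 1 <= x -> 1 <= Num.sqrt x.
  by move=> x1; rewrite -[X in X <= _]sqrtr1 ler_sqrt//; lra.
have y1 : 1 <= y by rewrite !sqrt_ge1.
have y4 : n%:R = y ^+ 4.
  by rewrite (exprM y 2 2) /y !sqr_sqrtr ?sqrtr_ge0.
have y0 : 0 < y by lra.
have S0 := drift_sum_ge0 n.+1.
have bn : 0 < b n.+1 by exact: b_gt0.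
have ln : 0 < lam n.+1 by exact: lam_gt0.
have l1 : 0 < lam 1 by exact: lam_gt0.
have ll : lam 1 <= lam n.+1 by exact: lam_nd.
have lower x : 0 < x -> x <= b n.+1 -> x <= y ->
    lam n.+1 * x * (1 - 5 / y ^+ 2) <= drift_sum n.+1.
  move=> x0 xb xy; apply: le_trans (drift_sum_ge n1 x0 xb).
  rewrite -mulrA ler_pM2l// y4 mulrBr mulr1 lerB//.
  rewrite ler_pdivrMr ?exprn_gt0//.
  rewrite [leRHS](_ : _ = x * (5 * y ^+ 2)); last by field; rewrite gt_eqF.
  rewrite [leLHS](_ : _ = x * (2 * x ^+ 2 + 3 * x)); last by ring.
  rewrite ler_pM2l//; nra.
have y2 : y <= y ^+ 2 by nra.
have small c : 0 < c -> c * (y - 5) <= drift_sum n.+1 ->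
    expR (- drift_sum n.+1) <= expR (5 * c) * (8`!%:R / c ^+ 8) / n%:R ^+ 2.
  move=> c0 cS; rewrite y4 -mulrA.
  apply: (@le_trans _ _ (expR (5 * c) * expR (- (c * y)))).
    by rewrite -expRD ler_expR; lra.
  by rewrite ler_pM2l ?expR_gt0// expRN_quartic.
have q0 c : 0 < c -> 0 <= expR (5 * c) * (8`!%:R / c ^+ 8) / n%:R ^+ 2 :> R.
  move=> c0; rewrite !mulr_ge0 ?expR_ge0 ?invr_ge0 ?exprn_ge0//; lra.
have E0 : 0 <= expR 5 * expR (- (lam n.+1 * b n.+1)).
  by rewrite mulr_ge0 ?expR_ge0.
have q1 : expR 5 * 8`!%:R = expR (5 * 1) * (8`!%:R / 1 ^+ 8) :> R.
  by rewrite mulr1 expr1n divr1.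
rewrite mulrDl q1; have := q0 1 ltr01; have := q0 _ l1.
have small1 := small _ l1; have small2 := small 1 ltr01.
have [by_|yb] := leP (b n.+1) y.
- have low := lower _ bn (lexx _) by_.
  have [xy|yx] := leP (lam n.+1 * b n.+1) (y ^+ 2).
    suff : expR (- drift_sum n.+1) <=
      expR 5 * expR (- (lam n.+1 * b n.+1)) by lra.
    rewrite -expRD ler_expR.
    suff : lam n.+1 * b n.+1 * (5 / y ^+ 2) <= 5 by lra.
    by rewrite mulrA ler_pdivrMr ?exprn_gt0//; lra.
  suff /small2 : 1 * (y - 5) <= drift_sum n.+1 by lra.
  have [y5|y5] := leP (y ^+ 2) 5; first lra.
  have : y ^+ 2 * (1 - 5 / y ^+ 2) <= lam n.+1 * b n.+1 * (1 - 5 / y ^+ 2).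
    rewrite ler_wpM2r ?(ltW yx)// subr_ge0 ler_pdivrMr ?exprn_gt0//; lra.
  rewrite mulrBr mulr1 mulrCA divff; last by rewrite gt_eqF ?exprn_gt0.
  lra.
suff /small1 : lam 1 * (y - 5) <= drift_sum n.+1 by lra.
have [y5|y5] := leP y 5; first by nra.
have low := lower _ y0 (ltW yb) (lexx _).
apply: le_trans low; rewrite -mulrA.
have -> : y * (1 - 5 / y ^+ 2) = y - 5 / y by field; rewrite gt_eqF.
have : 5 / y <= 5 by rewrite ler_pdivrMr//; lra.
have : 0 <= 5 / y by rewrite divr_ge0//; lra.
move: (5 / y) => c; nra.
Qed.

Lemma sum_inv_squares m : \sum_(k < m) (k.+1%:R ^+ 2)^-1 <= 2 :> R.
Proof.
case: m => [|m]; first by rewrite big_ord0.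
suff : \sum_(k < m.+1) (k.+1%:R ^+ 2)^-1 <= 2 - m.+1%:R^-1 :> R.
  by move=> /le_trans; apply; rewrite gerBl.
elim: m => [|m IHm].
  by rewrite big_ord_recr big_ord0 /= invr1 expr1n invr1; lra.
rewrite big_ord_recr /=; apply: (le_trans (lerD IHm (lexx _))).
have m0 : 0 < m.+1%:R :> R by rewrite ltr0n.
rewrite -subr_ge0 -[m.+2%:R]natr1; move: (m.+1%:R) m0 => z z0.
rewrite [leRHS](_ : _ = (z * (z + 1) ^+ 2)^-1).
  by rewrite invr_ge0 mulr_ge0 ?exprn_ge0//; lra.
by field; rewrite !gt_eqF//; lra.
Qed.

Lemma nneseries_oo (u : nat -> R) : (forall n, 0 <= u n) ->
  (\sum_(1 <= n <oo) (u n)%:E = +oo)%E <->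
  forall B, exists N, B < \sum_(1 <= n < N) u n.
Proof.
move=> u0; split => [uoo B|uB].
  apply: contrapT => nB.
  suff : (\sum_(1 <= n <oo) (u n)%:E <= B%:E)%E by rewrite uoo.
  apply: lime_le; first by apply: is_cvg_nneseries => n _ _; rewrite lee_fin.
  apply: nearW => N; rewrite sumEFin lee_fin leNgt.
  by apply/negP => uN; apply: nB; exists N.
apply/eqyP => B B0; have [N uN] := uB B.
apply: (@le_trans _ _ (\sum_(1 <= n < N) (u n)%:E)%E).
  by rewrite sumEFin lee_fin ltW.
by apply: nneseries_lim_ge => n _ _; rewrite lee_fin.
Qed.

Hypothesis b_nd : forall i j, (1 <= i <= j)%N -> b i <= b j.

Lemma drift_series_oo :
  (\sum_(1 <= n <oo) (expR (- drift_sum n))%:E = +oo)%E <->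
  (\sum_(1 <= n <oo) (expR (- (lam n * b n)))%:E = +oo)%E.
Proof.
have E0 (f : nat -> R) n : 0 <= expR (- f n) :> R by exact: expR_ge0.
rewrite (nneseries_oo (E0 drift_sum)).
rewrite (nneseries_oo (E0 (fun n => lam n * b n))).
split => uB B; last first.
  have [N uN] := uB B; exists N; apply: lt_le_trans uN _.
  apply: ler_sum_nat => n /andP[n1 _].
  by rewrite ler_expR lerN2 drift_sum_le.
pose K : R := expR 5 * 8`!%:R + expR (5 * lam 1) * (8`!%:R / lam 1 ^+ 8).
have K0 : 0 <= K.
  have l1 : 0 <= lam 1 by apply/ltW/lam_gt0.
  by rewrite addr_ge0// !mulr_ge0 ?expR_ge0// invr_ge0 exprn_ge0.
have [N uN] := uB (1 + K * 2 + expR 5 * `|B|).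
exists N.+2; apply: (@le_lt_trans _ _ `|B|); first exact: ler_norm.
rewrite -(ltr_pM2l (expR_gt0 5)) -(ltrD2l (1 + K * 2)).
apply: (lt_le_trans uN).

apply: (@le_trans _ _ (\sum_(1 <= n < N.+2) expR (- drift_sum n))).
  have [N0|N0] := leqP N 1; first by rewrite big_geq// sumr_ge0.
  rewrite [leRHS](@big_cat_nat _ _ _ N)//=; [|lia|lia].
  by rewrite lerDl sumr_ge0.
rewrite !big_add1 /= !big_nat_recl// !big_mkord.
have first_term : expR (- drift_sum 1) <= 1.
  by rewrite -[leRHS]expR0 ler_expR oppr_le0 drift_sum_ge0.
have first_ge0 : 0 <= expR 5 * expR (- (lam 1 * b 1)).
  by rewrite mulr_ge0// expR_ge0.
have other_terms : \sum_(i < N) expR (- drift_sum i.+2) <=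
    expR 5 * \sum_(i < N) expR (- (lam i.+2 * b i.+2)) + K * 2.
  rewrite mulr_sumr.
  apply: (@le_trans _ _ (\sum_(i < N)
      (expR 5 * expR (- (lam i.+2 * b i.+2)) + K / i.+1%:R ^+ 2))).
    by apply: ler_sum => i _; exact: expRN_drift_sum_le.
  rewrite big_split /= lerD2l -mulr_sumr ler_wpM2l//; exact: sum_inv_squares.
by rewrite mulrDr; lra.
Qed.

End drift_sums.

(** * Probabilities of barriers *)

Lemma poisson_series (R : realType) (lam q : R) : 0 < lam ->
  (\sum_(k <oo) (poisson_pmf lam k * q ^+ k)%:E =
    (expR (- (lam * (1 - q))))%:E)%E.
Proof.
move=> lam0; apply/cvg_lim => //.
rewrite (_ : (fun n => _) =
    EFin \o (fun n => expR (- lam) * series (exp_coeff (lam * q)) n)).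
  apply: cvg_EFin; first exact: nearW.
  rewrite mulrBr mulr1 opprB addrC expRD; apply: cvgMr.
  exact: is_cvg_series_exp_coeff.
apply/funext => n /=; rewrite sumEFin; congr (_%:E).
rewrite /series /= mulr_sumr; apply: eq_bigr => k _.
by rewrite /poisson_pmf lam0 /exp_coeff /= exprMn; ring.
Qed.

Section frog_probability.
Context d (T : measurableType d) (R : realType) (P : probability T R).
Variables (X : nat -> {RV P >-> nat})
  (L : nat -> nat -> nat -> {RV P >-> bool}).
Variables (p lambda : nat -> R).
Hypothesis model : frog_model X L p.
Hypothesis poisson :
  forall j, (1 <= j)%N -> poisson_distributed (X j) (lambda j).

(** The odds of a step to the right, which are also the probability that a frog
ever gets one site further. *)
Let rho j : R := (1 - p j) / p j.

Let p_bounds j : 1 / 2 < p j < 1. Proof. exact: frog_left_prob model j. Qed.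

Let rho_gt0 j : 0 < rho j.
Proof. by have := p_bounds j => pj; rewrite divr_gt0//; lra. Qed.

Let rho_lt1 j : rho j < 1.
Proof. by have := p_bounds j => pj; rewrite ltr_pdivrMr; lra. Qed.

Let rhoX_01 j r : 0 <= rho j ^+ r <= 1.
Proof. by rewrite exprn_ge0 ?exprn_ile1// ltW. Qed.

Lemma frog_sigma_sigma v : sigma_algebra setT (frog_sigma X L v).
Proof.
by case: v => [j|[[j i] t]]; apply: sigma_algebra_preimage;
  exact: sigma_algebra_measurable.
Qed.

Lemma frog_sigma_measurable v : frog_sigma X L v `<=` measurable.
Proof.
by case: v => [j|[[j i] t]] _ [B mB <-]; apply: measurable_funP.
Qed.

Let F_sigma := frog_sigma_sigma.
Let F_meas := frog_sigma_measurable.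
Let F_indep : mutual_independence P (frog_sigma X L) := frog_independence model.

Local Notation gen := (generated (frog_sigma X L)).
Local Notation xs w := (fun j => X j w).
Local Notation ls w := (fun j i t => L j i t w).

Definition site_of (v : nat + nat * nat * nat) : nat :=
  match v with inl j => j.+1 | inr (j, _, _) => j end.

Definition sites (B : set nat) : set (nat + nat * nat * nat) := site_of @^-1` B.

Lemma sites_disjoint (B B' : set nat) : (forall j, B j -> ~ B' j) ->
  sites B `&` sites B' = set0.
Proof. by move=> BB'; apply/seteqP; split => // v [/BB']. Qed.

Lemma step_sigma j i t b :
  frog_sigma X L (inr (j, i, t)) [set w | L j i t w = b].
Proof. by exists [set b] => //; rewrite setTI. Qed.

Lemma generated_frog_reaches (B : set (nat + nat * nat * nat)) j i b r :
  (forall t, B (inr (j, i, t))) -> gen B [set w | reaches b (ls w j i) r].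
Proof.
move=> Bji; exact: (@generated_reaches _ _ _ _ (fun t => inr (j, i, t))
  (fun t w => L j i t w) (step_sigma j i) B b 0 r (fun v => Bji v)).
Qed.

Lemma generated_count (B : set (nat + nat * nat * nat)) j (Q : nat -> Prop) :
  B (inl j) -> gen B [set w | Q (X j.+1 w)].
Proof.
move=> Bj; apply: generated_gen Bj _.
by exists [set k | Q k] => //; rewrite setTI.
Qed.

Lemma generated_frogs (B : set nat) j (Q : nat -> Prop) :
  B j -> gen (sites B) [set w | Q (frogs (xs w) j)].
Proof.
case: j => [|j] Bj; first exact: (@generated_cst _ _ _ _ (Q 1%N)).
exact: generated_count.
Qed.

Lemma generated_blocked (B : set nat) j r :
  B j -> gen (sites B) [set w | blocked (xs w) (ls w) j r].
Proof.
move=> Bj; apply: generated_forall => i; apply: generated_imply.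
  exact: (@generated_frogs B j (fun k => (i < k)%N)).
by apply: generated_not; exact: generated_frog_reaches.
Qed.

Lemma gen_measurable B E : gen B E -> measurable E.
Proof. by move=> BE; apply: (generated_measurable F_meas BE). Qed.

Lemma gen_independence B B' E E' : B `&` B' = set0 -> gen B E -> gen B' E' ->
  P (E `&` E') = (P E * P E')%E.
Proof. exact: (block_independence F_sigma F_meas F_indep). Qed.

Lemma step_left j i t : P [set w | L j i t w == true] = (p j)%:E.
Proof.
rewrite -(frog_step model j i t); congr (P _).
by apply/seteqP; split => w /= /eqP.
Qed.

Lemma step_right j i t : P [set w | L j i t w == false] = (1 - p j)%:E.
Proof.
rewrite EFinB -(step_left j i t) -probability_setC.
  by congr (P _); apply/seteqP; split => w /=; case: (L j i t w).
have := @generated_step _ _ _ _ (fun t => inr (j, i, t))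
  (fun t w => L j i t w) (step_sigma j i) setT t true Logic.I.
exact: gen_measurable.
Qed.

Let idx_inj j i : injective (fun t => inr (j, i, t) : nat + nat * nat * nat).
Proof. by move=> t t' [->]. Qed.

(** To the right the chance [1 - p j] of a step is less than one half, so the
smaller root of the fixed-point equation is [rho j]. *)
Lemma probability_not_reaches_right j i r :
  P [set w | ~ reaches false (ls w j i) r] = (1 - rho j ^+ r)%:E.
Proof.
have pj := p_bounds j; have := rho_gt0 j; have := rho_lt1 j => r1 r0.
apply: (@probability_not_reaches _ _ _ P _ _ F_sigma F_meas F_indep
  (fun t => inr (j, i, t)) (fun t w => L j i t w) (step_sigma j i)
  (@idx_inj j i) false (1 - p j) (step_right j i) (rho j)).
- lra.
- by rewrite lt_eqF//; lra.
- exact: ltW.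
- by rewrite /rho; field; rewrite gt_eqF//; lra.
rewrite opprB addrCA subrr addr0 -/(rho j).
by rewrite expr2 ler_piMl// ltW.
Qed.

(** To the left, along the drift, the smaller root is [1]. *)
Lemma probability_not_reaches_left j i r :
  P [set w | ~ reaches true (ls w j i) r] = 0%E.
Proof.
have pj := p_bounds j.
rewrite (@probability_not_reaches _ _ _ P _ _ F_sigma F_meas F_indep
  (fun t => inr (j, i, t)) (fun t w => L j i t w) (step_sigma j i)
  (@idx_inj j i) true (p j) (step_left j i) 1).
- by rewrite expr1n subrr.
- lra.
- by rewrite gt_eqF//; lra.
- exact: ler01.
- by ring.
by rewrite expr1n ler_pdivlMr; lra.
Qed.

(** At a nonpositive rate [poisson_pmf] is constantly [1], which would make the
site almost surely empty. *)
Lemma lambda_gt0 j : (1 <= j)%N -> 0 < lambda j.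
Proof.
move=> j1; rewrite ltNge; apply/negP => l0.
have := frog_count_gt0 model j1.
rewrite (_ : [set w | _] = ~` [set w | X j w = 0%N]); last first.
  by apply/seteqP; split => w /=; case: (X j w).
rewrite probability_setC; last first.
  case: j j1 {l0} => // j _.
  by apply: gen_measurable; exact: (@generated_count setT j (fun k => k = 0%N)).
by rewrite poisson// /poisson_pmf [0 < lambda j]ltNge l0 /= subee// ltxx.
Qed.

(** Stochastic dominance is used for the events that a site is nonempty, whose
probabilities are [1 - expR (- lambda j)]. *)
Lemma lambda_nondecreasing i j : (1 <= i <= j)%N -> lambda i <= lambda j.
Proof.
apply: nondecreasing_from1 => {i j}k k1.
have := frog_count_dominance model k1 1.
have PX m : (1 <= m)%N ->
    P [set w | (1 <= X m w)%N] = (1 - expR (- lambda m))%:E.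
  move=> m1; rewrite (_ : [set w | _] = ~` [set w | X m w = 0%N]); last first.
    by apply/seteqP; split => w /=; case: (X m w).
  rewrite probability_setC; last first.
    case: m m1 => // m _.
    apply: gen_measurable.
    exact: (@generated_count setT m (fun k => k = 0%N)).
  by rewrite poisson// /poisson_pmf lambda_gt0// expr0 fact0 invr1 !mul1r.
by rewrite !PX// lee_fin lerD2l lerN2 ler_expR lerN2.
Qed.

Lemma probability_all_frogs_not_reach j r k :
  P [set w | forall i, (i < k)%N -> ~ reaches false (ls w j i) r] =
  ((1 - rho j ^+ r) ^+ k)%:E.
Proof.
elim: k => [|k IHk].
  by rewrite expr0 -(probability_setT P); congr (P _); apply/seteqP; split.
rewrite (_ : [set w | _] =
    [set w | forall i, (i < k)%N -> ~ reaches false (ls w j i) r] `&`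
    [set w | ~ reaches false (ls w j k) r]); last first.
  apply/seteqP; split => w /= => [nr|[nr nrk] i].
    by split => [i ik|]; apply: nr => //; exact: ltnW.
  by rewrite ltnS leq_eqVlt => /orP[/eqP ->|/nr].
rewrite (@gen_independence
  [set v | exists i t, (i < k)%N /\ v = inr (j, i, t)]
  [set v | exists t, v = inr (j, k, t)]).
- by rewrite IHk probability_not_reaches_right -EFinM exprSr.
- apply/seteqP; split => // v [[i [t [ik ->]]] [t' [ik']]].
  by move: ik; rewrite ik' ltnn.
- apply: generated_forall => i; apply: generated_when => ik.
  by apply: generated_not; apply: generated_frog_reaches => t; exists i, t.
by apply: generated_not; apply: generated_frog_reaches => t; exists t.
Qed.

Definition blocked_prob j r : R :=
  if j == 0%N then 1 - rho 0 ^+ r else expR (- (lambda j * rho j ^+ r)).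

(** For [1 <= j] this is Poisson thinning: the frogs of site [j] that advance by
[r] are Poisson in number, with mean [lambda j * rho j ^+ r]. *)
Lemma probability_blocked j r :
  P [set w | blocked (xs w) (ls w) j r] = (blocked_prob j r)%:E.
Proof.
rewrite /blocked_prob; case: eqP => [->|/eqP j0].
  rewrite -(probability_not_reaches_right 0 0 r); congr (P _).
  by apply/seteqP; split => w /= => [|nr [|i]//]; exact.
pose E k := [set w | X j w = k] `&`
  [set w | forall i, (i < k)%N -> ~ reaches false (ls w j i) r].
have genX k : gen [set inl j.-1] [set w | X j w = k].
  case: j j0 {E} => // j _.
  exact: (@generated_count [set inl j] j (fun k' => k' = k)).
have genE k : gen [set v | exists i t, v = inr (j, i, t)]
   [set w | forall i, (i < k)%N -> ~ reaches false (ls w j i) r].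
  apply: generated_forall => i; apply: generated_when => _.
  by apply: generated_not; apply: generated_frog_reaches => t; exists i, t.
have mE k : measurable (E k).
  by apply: measurableI; apply: gen_measurable; eauto.
have PE k : P (E k) = (poisson_pmf (lambda j) k * (1 - rho j ^+ r) ^+ k)%:E.
  rewrite (gen_independence _ (genX k) (genE k)).
    by rewrite probability_all_frogs_not_reach poisson// lt0n.
  by apply/seteqP; split => // v [/= -> [i [t]]].
rewrite (_ : [set w | _] = \bigcup_k E k).
  rewrite measure_semi_bigcup//.
  - rewrite (eq_eseriesr (fun k _ => PE k)) poisson_series ?lambda_gt0 ?lt0n//.
    by rewrite opprB addrCA subrr addr0.
  - by move=> k k' _ _ [w [[/= <- _] [/= <- _]]].
  exact: bigcupT_measurable.
apply/seteqP; split => w.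
  move=> bw; exists (X j w) => //; split => //= i ij; apply: bw.
  by rewrite /frogs (negPf j0).
move=> [k _ [/= Xk nr]] i; rewrite /frogs (negPf j0) Xk; exact: nr.
Qed.

Lemma generated_all_blocked (B : set nat) n m (r : nat -> nat) :
  (forall j, (n <= j < m)%N -> B j) ->
  gen (sites B) [set w | forall j, (n <= j < m)%N ->
    blocked (xs w) (ls w) j (r j)].
Proof.
move=> BB; apply: generated_forall => j; apply: generated_when => nj.
by apply: generated_blocked; exact: BB.
Qed.

Lemma probability_all_blocked n m (r : nat -> nat) : (n <= m)%N ->
  P [set w | forall j, (n <= j < m)%N -> blocked (xs w) (ls w) j (r j)] =
  (\prod_(n <= j < m) blocked_prob j (r j))%:E.
Proof.
move=> /subnK <-; elim: (m - n)%N => [|k IHk].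
  rewrite add0n big_geq// -(probability_setT P); congr (P _).
  by apply/seteqP; split => // w _ j; lia.
rewrite addSn big_nat_recr ?leq_addl//= EFinM -IHk -probability_blocked.
rewrite -(@gen_independence (sites (fun j => (n <= j < k + n)%N))
  (sites [set (k + n)%N])); first last.
- exact: generated_blocked.
- exact: generated_all_blocked.
- by apply: sites_disjoint => j /= nj jk; lia.
congr (P _); apply/seteqP; split => w /= => [bw|[bw bk] j].
  by split => [j nj|]; apply: bw; lia.
have [->//|nj] := eqVneq j (k + n)%N; move=> jk; apply: bw; lia.
Qed.

Definition barrier_event n m := [set w | barrier (xs w) (ls w) n m].

Let barrier_eventE n m : barrier_event n m =
  [set w | forall j, (n <= j < m.+1)%N -> blocked (xs w) (ls w) j (m.+1 - j)].
Proof.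
apply/seteqP; split => w bw j; first by move=> /andP[nj jm]; exact: bw.
by move=> nj jm; apply: bw; rewrite nj.
Qed.

Lemma generated_barrier (B : set nat) n m :
  (forall j, (n <= j <= m)%N -> B j) -> gen (sites B) (barrier_event n m).
Proof. by move=> BB; rewrite barrier_eventE; apply: generated_all_blocked. Qed.

Lemma barrier_measurable n m : measurable (barrier_event n m).
Proof. by apply: (@gen_measurable (sites setT)); exact: generated_barrier. Qed.

Definition barrier_prob n m : R :=
  \prod_(n <= j < m.+1) blocked_prob j (m.+1 - j).

Lemma probability_barrier n m : (n <= m.+1)%N ->
  P (barrier_event n m) = (barrier_prob n m)%:E.
Proof. by move=> nm; rewrite barrier_eventE probability_all_blocked. Qed.

Lemma blocked_prob_ge0 j r : 0 <= blocked_prob j r.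
Proof.
rewrite /blocked_prob; case: eqP => _; last exact: expR_ge0.
by rewrite subr_ge0; have /andP[] := rhoX_01 0 r.
Qed.

Lemma barrier_prob_ge0 n m : 0 <= barrier_prob n m.
Proof. by apply: prodr_ge0 => j _; exact: blocked_prob_ge0. Qed.

Lemma barrier_prob0 m :
  barrier_prob 0 m = (1 - rho 0 ^+ m.+1) * barrier_prob 1 m.
Proof. by rewrite /barrier_prob big_ltn. Qed.

Lemma rho_nondecreasing i j : (1 <= i <= j)%N -> rho i <= rho j.
Proof.
apply: nondecreasing_from1 => {i j}k /(frog_left_prob_decreasing model) pk.
have := p_bounds k; have := p_bounds k.+1 => p1 p0.
rewrite /rho ler_pdivrMr; last lra.
rewrite mulrAC ler_pdivlMr; last lra.
by move: (p k) (p k.+1) pk p0 p1 => y z; nra.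
Qed.

(** Frog numbers and the chance of a frog to advance both grow with the site,
so translating a barrier to the right makes it less likely. *)
Lemma barrier_prob_shift n m : (n <= m)%N ->
  barrier_prob n.+1 m <= barrier_prob 1 (m - n).
Proof.
move=> nm; rewrite /barrier_prob !big_add1 /= (_ : n = 0 + n)%N// big_addn.
rewrite add0n; rewrite 2!big_nat; apply: ler_prod => i /andP[_ im].
rewrite blocked_prob_ge0 /= /blocked_prob /= ler_expR lerN2.
have -> : (m.+1 - (i + n).+1 = (m - n).+1 - i.+1)%N by lia.
have li : (1 <= i.+1 <= (i + n).+1)%N by lia.
apply: ler_pM.
- by apply/ltW/lambda_gt0.
- by have /andP[] := rhoX_01 i.+1 ((m - n).+1 - i.+1).
- exact: lambda_nondecreasing.
by rewrite lerXn2r ?nnegrE ?(ltW (rho_gt0 _))// rho_nondecreasing.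
Qed.

Lemma generated_frog_walk j i t z :
  gen setT [set w | frog_walk (ls w) j i t = z].
Proof.
rewrite (_ : [set w | _] = [set w | walk false (ls w j i) t = z - j%:Z]).
  exact: (@generated_walk _ _ _ _ (fun t => inr (j, i, t))
    (fun t w => L j i t w) (step_sigma j i) setT false 0 t _
    (fun v => Logic.I)).
by apply/seteqP; split => w /=; rewrite frog_walk_right; lia.
Qed.

Lemma generated_wake_time n k m :
  gen setT [set w | wake_time (xs w) (ls w) n k = Some m].
Proof.
elim: n k m => [|n IHn] k m.
  exact: (@generated_cst _ _ _ _
    ((if k == 0%N then Some 0%N else None) = Some m)).
rewrite (_ : [set w | _] = [set w |
    wake_time (xs w) (ls w) n k = Some m \/
    ((forall m', ~ wake_time (xs w) (ls w) n k = Some m') /\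
    (exists j i m', (i < frogs (xs w) j)%N /\
      wake_time (xs w) (ls w) n j = Some m' /\
      frog_walk (ls w) j i (n.+1 - m') = k%:Z)) /\ n.+1 = m]).
  apply: generated_or => //.
  apply: generated_and; last exact: (@generated_cst _ _ _ _ (n.+1 = m)).
  apply: generated_and.
    by apply: generated_forall => m'; apply: generated_not.
  apply: generated_exists => j; apply: generated_exists => i.
  apply: generated_exists => m'; apply: generated_and.
    exact: (@generated_frogs setT j (fun k => (i < k)%N)).
  by apply: generated_and => //; exact: generated_frog_walk.
apply/seteqP; split => w; rewrite /mkset wake_timeS.
  case: (wake_time _ _ n k) => [m'|]; first by left.
  case: asboolP => // -[j [i [m' [ij jm' jk]]]] [nm]; right.
  by split => //; split => //; exists j, i, m'.
case: (wake_time _ _ n k) => [m'|] [//|[[wn ex] nm]]; first by have := wn m'.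
rewrite -nm ifT//; apply/asboolP; move: ex => [j [i [m' [ij [jm' jk]]]]].
by exists j, i, m'; split.
Qed.

Let many_hits := [set w | infinite_set [set f : nat * nat |
  hits_origin (xs w) (ls w) f.1 f.2]].

Lemma many_hits_measurable : measurable many_hits.
Proof.
apply: (@gen_measurable setT).
rewrite (_ : many_hits = [set w | forall n, exists j i,
    (n <= j + i)%N /\ hits_origin (xs w) (ls w) j i]); last first.
  apply/seteqP; split => w; first by move/(infinite_pairsP (hits_origin _ _)).
  by move=> h; apply/(infinite_pairsP (hits_origin _ _)).
apply: generated_forall => n; apply: generated_exists => j.
apply: generated_exists => i; apply: generated_and.
  exact: (@generated_cst _ _ _ _ (is_true _)).
apply: generated_and.
  exact: (@generated_frogs setT j (fun k => (i < k)%N)).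
apply: generated_exists => n'; apply: generated_exists => m.
apply: generated_and; first exact: generated_wake_time.
exact: generated_frog_walk.
Qed.

(** * Divergence of the barrier series *)

Let first_barrier n := [set w | barrier (xs w) (ls w) 0 n /\
  forall k, (k < n)%N -> ~ barrier (xs w) (ls w) 0 k].

Let generated_first_barrier n : gen (sites `I_n.+1) (first_barrier n).
Proof.
apply: generated_and; first by apply: generated_barrier => j /=; lia.
apply: generated_forall => k; apply: generated_when => kn.
by apply: generated_not; apply: generated_barrier => j /=; lia.
Qed.

Let first_barrier_measurable n : measurable (first_barrier n).
Proof. by apply: gen_measurable; exact: generated_first_barrier. Qed.

Let first_prob n : R := fine (P (first_barrier n)).

Let PfirstE n : P (first_barrier n) = (first_prob n)%:E.
Proof. by rewrite fineK// fin_num_measure. Qed.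

Let some_barrier := \bigcup_n barrier_event 0 n.

Let some_barrier_measurable : measurable some_barrier.
Proof. by apply: bigcupT_measurable => n; exact: barrier_measurable. Qed.

Let some_prob : R := fine (P some_barrier).

Let PsomeE : P some_barrier = some_prob%:E.
Proof. by rewrite fineK// fin_num_measure. Qed.

(** If the first barrier starting at [0] occurs at [n], then [barrier 0 m]
entails [barrier n.+1 m], which is independent of the sites up to [n]. *)
Let barrier_decomp m :
  barrier_prob 0 m <= \sum_(n < m.+1) first_prob n * barrier_prob 1 (m - n).
Proof.
pose E n := first_barrier n `&` barrier_event n.+1 m.
have mE n : measurable (E n).
  by apply: measurableI => //; exact: barrier_measurable.
have PE n : (n <= m)%N ->
    (P (E n) <= (first_prob n * barrier_prob 1 (m - n))%:E)%E.
  move=> nm; have gB : gen (sites [set j | (n < j)%N]) (barrier_event n.+1 m).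
    by apply: generated_barrier => j /=; lia.
  rewrite (gen_independence _ (@generated_first_barrier n) gB).
    rewrite PfirstE probability_barrier// -EFinM lee_fin ler_wpM2l//.
      exact: fine_ge0.
    exact: barrier_prob_shift.
  by apply: sites_disjoint => j /=; lia.
rewrite -lee_fin -probability_barrier// -sumEFin.
apply: (@le_trans _ _ (P (\big[setU/set0]_(n < m.+1) E n))).
  apply: le_measure; rewrite ?inE; [exact: barrier_measurable| |].
    by apply: bigsetU_measurable.
  move=> w bw; rewrite -bigcup_mkord.
  have exb : exists k, `[< barrier (xs w) (ls w) 0 k >].
    by exists m; exact/asboolP.
  case: (ex_minnP exb) => k /asboolP bk mink.
  have km : (k <= m)%N by apply: mink; exact/asboolP.
  exists k; first by rewrite /= ltnS.
  split; last by move=> j kj jm; exact: bw.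
  split => // k' kk' bk'; have := mink k' (asboolT bk').
  by rewrite leqNgt kk'.
apply: (le_trans (Boole_inequality _ _)) => //.
by apply: lee_sum => n _; apply: PE; rewrite -ltnS.
Qed.

Let sum_first_prob M : \sum_(n < M) first_prob n <= some_prob.
Proof.
rewrite -lee_fin -PsomeE -sumEFin.
apply: (@le_trans _ _ (P (\bigcup_n first_barrier n))); last first.
  apply: le_measure; rewrite ?inE//; first exact: bigcupT_measurable.
  by move=> w [n _ [bn _]]; exists n.
rewrite measure_semi_bigcup//; last 2 first.
- move=> n n' _ _ [w [[bn mn] [bn' mn']]].
  have [nn'|nn'|//] := ltngtP n n'; first by case: (mn' _ nn').
  by case: (mn _ nn').
- exact: bigcupT_measurable.
rewrite -(big_mkord xpredT (fun n => (first_prob n)%:E)).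
under eq_bigr do rewrite -PfirstE.
exact: nneseries_lim_ge.
Qed.

Let barrier_sum M :
  \sum_(m < M) \sum_(n < m.+1) first_prob n * barrier_prob 1 (m - n) =
  \sum_(n < M) first_prob n * \sum_(k < M - n) barrier_prob 1 k.
Proof.
elim: M => [|M IHM]; first by rewrite !big_ord0.
rewrite big_ord_recr /= IHM [in RHS]big_ord_recr /= subSnn big_ord1.
rewrite [in LHS](big_ord_recr M) /= subnn addrA; congr (_ + _).
rewrite -big_split /=; apply: eq_bigr => n _.
by rewrite subSn 1?ltnW// big_ord_recr /= mulrDr.
Qed.

(** Decomposing according to the first barrier gives a renewal inequality: the
expected number of barriers up to [M] is at most the probability of ever
seeing one times the same expectation for the process without the initial
frog, from which it differs by a bounded amount. *)
Lemma some_barrier_bound M :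
  (1 - some_prob) * \sum_(m < M) barrier_prob 1 m <= (1 - rho 0)^-1.
Proof.
pose U := \sum_(m < M) barrier_prob 1 m.
have upper : \sum_(m < M) barrier_prob 0 m <= some_prob * U.
  apply: (@le_trans _ _ (\sum_(n < M) first_prob n * U)).
    apply: (le_trans (ler_sum _ (fun (m : 'I_M) _ => barrier_decomp m))).
    rewrite barrier_sum; apply: ler_sum => n _.
    rewrite ler_wpM2l ?fine_ge0// /U -!(big_mkord xpredT).
    rewrite [leRHS](@big_cat_nat _ _ _ (M - n))//= ?leq_subr//.
    by rewrite lerDl sumr_ge0// => k _; exact: barrier_prob_ge0.
  rewrite -mulr_suml ler_wpM2r// sumr_ge0// => k _; exact: barrier_prob_ge0.
have diff : U - \sum_(m < M) barrier_prob 0 m <= (1 - rho 0)^-1.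
  rewrite -sumrB.
  apply: (@le_trans _ _ (\sum_(m < M) rho 0 ^+ m)).
    apply: ler_sum => m _.
    rewrite barrier_prob0 mulrBl mul1r opprB addrCA subrr addr0.
    have le1 : barrier_prob 1 m <= 1.
      rewrite -lee_fin -probability_barrier// probability_le1//.
      exact: barrier_measurable.
    rewrite exprS -mulrA -[leRHS]mul1r ler_pM//.
    - exact/ltW/rho_gt0.
    - by rewrite mulr_ge0 ?exprn_ge0 ?barrier_prob_ge0// ltW.
    - exact: ltW.
    by rewrite ler_piMr// exprn_ge0// ltW.
  rewrite -[leRHS]mul1r ler_pdivlMr ?subr_gt0// mulrC.
  rewrite -opprB mulNr -subrX1 opprB gerBl exprn_ge0//; exact/ltW/rho_gt0.
by rewrite -/U mulrBl mul1r; move: upper diff; lra.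
Qed.

(** By [some_barrier_bound] a divergent series leaves no mass to the event that
no barrier ever occurs, and a single barrier leaves only finitely many frogs
that can wake up. *)
Lemma divergent_transient :
  (forall B, exists N, B < \sum_(1 <= n < N) barrier_prob 1 n) -> transient X L.
Proof.
move=> dv; have some1 : some_prob = 1.
  apply/eqP; rewrite eq_le; apply/andP; split.
    by rewrite -lee_fin -PsomeE probability_le1.
  rewrite leNgt; apply/negP => s1.
  have s0 : 0 < 1 - some_prob by rewrite subr_gt0.
  have [N] := dv ((1 - some_prob)^-1 * (1 - rho 0)^-1).
  apply/negP; rewrite -leNgt ler_pdivlMl//.
  apply: le_trans (some_barrier_bound N); rewrite ler_pM2l//.
  case: N => [|N]; first by rewrite big_geq// big_ord0.
  by rewrite -(big_mkord xpredT) /= [leRHS]big_ltn// lerDr barrier_prob_ge0.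
apply/eqP; rewrite eq_le measure_ge0 andbT.
apply: (@le_trans _ _ (P (~` some_barrier))); last first.
  by rewrite probability_setC// PsomeE some1 subee.
apply: le_measure; rewrite ?inE; first exact: many_hits_measurable.
  exact: measurableC.
by move=> w inf [n _ bn]; apply: inf; exact: barrier_finite bn.
Qed.

(** * Convergence of the barrier series *)

(** Level [0] is reached at once, so [blocked j 0] says that site [j] is empty;
this has probability [expR (- lambda j)], at most [expR (- lambda 1)]. *)
Lemma no_frogs_beyond_null m :
  P [set w | forall j, (m < j)%N -> blocked (xs w) (ls w) j 0] = 0%E.
Proof.
set E := [set w | _].
have mE : measurable E.
  apply: (@gen_measurable (sites setT)); apply: generated_forall => j.
  by apply: generated_when => _; exact: generated_blocked.
have PE : P E = (fine (P E))%:E by rewrite fineK// fin_num_measure.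
pose q := expR (- lambda 1); have q0 : 0 <= q by exact: expR_ge0.
have l1 : 0 < lambda 1 by exact: lambda_gt0.
have q1 : q < 1 by rewrite -expR0 ltr_expR oppr_lt0.
have Ek k : fine (P E) <= q ^+ k.
  rewrite -lee_fin -PE.
  apply: (@le_trans _ _ (\prod_(m.+1 <= j < m.+1 + k) blocked_prob j 0)%:E).
    rewrite -(@probability_all_blocked _ _ (fun=> 0%N)) ?leq_addr//.
    apply: le_measure; rewrite ?inE//.
      by apply: (@gen_measurable (sites setT)); exact: generated_all_blocked.
    by move=> w Ew j /andP[mj _]; exact: Ew.
  rewrite lee_fin -(_ : \prod_(m.+1 <= j < m.+1 + k) q = q ^+ k); last first.
    by rewrite prodr_const_nat addKn.
  rewrite 2!big_nat; apply: ler_prod => j /andP[mj _].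
  rewrite blocked_prob_ge0 /= /blocked_prob gtn_eqF ?(leq_ltn_trans _ mj)//.
  rewrite expr0 mulr1 ler_expR lerN2 lambda_nondecreasing//=.
  exact: leq_trans mj.
rewrite PE; congr (_%:E); apply/eqP; rewrite eq_le fine_ge0// andbT.
have qk : (fun k => q ^+ k) @ \oo --> (0 : R).
  by apply: cvg_expr; rewrite ger0_norm.
have <- := cvg_lim (@Rhausdorff R) qk.
by apply: limr_ge; [apply: cvgP qk|exact: nearW].
Qed.

Let quiet M := [set w | forall n, (M <= n)%N -> ~ barrier (xs w) (ls w) 1 n].

Let generated_quiet M : gen (sites [set j | (0 < j)%N]) (quiet M).
Proof.
apply: generated_forall => n; apply: generated_when => _.
by apply: generated_not; apply: generated_barrier => j /= /andP[].
Qed.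

Let quiet_measurable M : measurable (quiet M).
Proof. by apply: gen_measurable; exact: generated_quiet. Qed.

(** By the Borel-Cantelli lemma almost surely only finitely many barriers occur,
so the events [quiet M] exhaust the probability space up to a null set. *)
Lemma quiet_positive : (\sum_(1 <= n <oo) (barrier_prob 1 n)%:E < +oo)%E ->
  exists2 M, (1 <= M)%N & P (quiet M) != 0%E.
Proof.
move=> cv; apply: contrapT => nM.
have quiet0 M : P (quiet M.+1) = 0%E.
  by apply: contrapT => /eqP qM; apply: nM; exists M.+1.
pose A n := if (1 <= n)%N then barrier_event 1 n else set0.
have mA n : measurable (A n).
  by rewrite /A; case: ifP => // _; exact: barrier_measurable.
have limsup0 : P (lim_sup_set A) = 0%E.
  apply: lim_sup_set_cvg0 => //; apply: le_lt_trans cv.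
  rewrite [leRHS]eseries_cond [leRHS]eseries_mkcond.
  rewrite le_eqVlt; apply/orP; left; apply/eqP.
  apply: eq_eseriesr => -[|n] _; rewrite /A /=.
    by rewrite measure0.
  exact: probability_barrier.
have mlim : measurable (lim_sup_set A).
  by apply: bigcapT_measurable => n; apply: bigcup_measurable => k _.
suff : P.-negligible setT.
  move=> negT; have : P setT = 0%E by apply/(negligibleP P measurableT).
  by rewrite probability_setT => /eqP; rewrite onee_eq0.
apply: (@negligibleS _ _ _ _ (lim_sup_set A `|` \bigcup_M quiet M.+1)).
  move=> w _; have [|nlim] := pselect (lim_sup_set A w); [by left|right].
  apply: contrapT => nq; apply: nlim => n _; apply: contrapT => nA; apply: nq.
  exists n => // k nk bk; apply: nA; exists k; first exact: ltnW.
  by rewrite /A (leq_trans _ nk).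
apply: negligibleU; first exact/(negligibleP P mlim).
apply: negligible_bigcup => M.
by apply/(negligibleP P (@quiet_measurable M.+1)); exact: quiet0.
Qed.

(** When no barrier occurs from [M] on and the frog of the origin reaches [M],
every site wakes up. Apart from null sets, infinitely many of the sites carry
frogs, and all of these frogs visit the origin. *)
Lemma convergent_not_transient :
  (\sum_(1 <= n <oo) (barrier_prob 1 n)%:E < +oo)%E -> ~ transient X L.
Proof.
move=> /quiet_positive[M M1 qM] tr.
pose reach := [set w | reaches false (ls w 0 0) M].
have genr : gen (sites [set 0%N]) reach by exact: generated_frog_reaches.
have reachM : P reach = (rho 0 ^+ M)%:E.
  have mr := gen_measurable genr.
  have := probability_not_reaches_right 0 0 M.
  rewrite -[[set w | ~ _]]/(~` reach) probability_setC//.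
  rewrite -(@fineK _ (P reach)) ?fin_num_measure//.
  by rewrite -EFinB => -[] ?; congr (_%:E); lra.
(* The initial frog is independent of the barriers, which start at site 1. *)
suff : P.-negligible (reach `&` quiet M).
  have mW : measurable (reach `&` quiet M).
    by apply: measurableI => //; exact: (gen_measurable genr).
  move=> negW; have : P (reach `&` quiet M) = 0%E by apply/(negligibleP P mW).
  rewrite (gen_independence _ genr (@generated_quiet M)).
    rewrite reachM => /eqP; rewrite mule_eq0 (negPf qM) orbF eqe.
    by rewrite expf_eq0 gt_eqF ?andbF.
  by apply: sites_disjoint => j /= ->.
pose stray j i := [set w | ~ reaches true (ls w j i) j].
pose empty m := [set w | forall j, (m < j)%N -> blocked (xs w) (ls w) j 0].
apply: (@negligibleS _ _ _ _ (many_hits `|`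
    ((\bigcup_j \bigcup_i stray j i) `|` \bigcup_m empty m))).
  move=> w [rw qw]; apply: contrapT => /not_orP[nmany /not_orP[nstray nempty]].
  apply: nmany; apply/(infinite_pairsP (hits_origin _ _)) => n.
  have [j [nj [i ij]]] :
      exists j, (n < j)%N /\ exists i, (i < frogs (xs w) j)%N.
    apply: contrapT => nj; apply: nempty; exists n => // j jn i ij _.
    by apply: nj; exists j; split => //; exists i.
  exists j, i; split; first exact/(leq_trans (ltnW nj))/leq_addr.
  apply: awake_hits_origin => //; first exact: all_awake rw qw _.
  by apply: contrapT => nr; apply: nstray; exists j => //; exists i.
apply: negligibleU; first exact/(negligibleP P many_hits_measurable).
apply: negligibleU; apply: negligible_bigcup => j.
  apply: negligible_bigcup => i; apply/negligibleP.
    apply: (@gen_measurable setT).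
    by apply: generated_not; exact: generated_frog_reaches.
  exact: probability_not_reaches_left.
apply/negligibleP; last exact: no_frogs_beyond_null.
apply: (@gen_measurable (sites setT)); apply: generated_forall => k.
by apply: generated_when => _; exact: generated_blocked.
Qed.

Lemma barrier_probE (b : nat -> R) n :
  (forall j, (1 <= j)%N -> rho j = b j / (1 + b j)) ->
  barrier_prob 1 n = expR (- drift_sum lambda b n).
Proof.
move=> rhoE; rewrite /drift_sum -sumrN (big_morph expR (@expRD R) (@expR0 R)).
rewrite /barrier_prob !big_nat; apply: eq_bigr => j /andP[j1 _].
by rewrite /blocked_prob gtn_eqF// rhoE.
Qed.

End frog_probability.

Theorem theorem3p2 (d : measure_display) (T : measurableType d) (R : realType)
    (P : probability T R) (X : nat -> {RV P >-> nat})
    (L : nat -> nat -> nat -> {RV P >-> bool}) (p a lambda : nat -> R)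
    (model : frog_model X L p)
    (poisson : forall j, (1 <= j)%N -> poisson_distributed (X j) (lambda j))
    (p_a : forall j, p j = 1 / 2 + a j)
    (concave_inva : concave_seq (fun j => 1 / a j))
    (concave_lambda : concave_seq lambda) :
  transient X L <->
  (\sum_(1 <= n <oo)
     (expR (- lambda n * (1 / (4 * a n) - 1 / 2)))%:E = +oo)%E.
Proof.
pose b j := 1 / (4 * a j) - 1 / 2.
have a_bounds j : 0 < a j < 1 / 2.
  by have := frog_left_prob model j; rewrite p_a; lra.
have a_gt0 j : 0 < a j by case/andP: (a_bounds j).
have bE j : b j = 1 / 4 * (1 / a j) - 1 / 2.
  by rewrite /b; field; rewrite gt_eqF.
have inva_gt2 j : 2 < 1 / a j.
  by rewrite ltr_pdivlMr//; have := a_bounds j; lra.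
have b_gt0 j : 0 < b j by rewrite bE; have := inva_gt2 j; lra.
have b_concave : concave_seq b.
  by move=> i j ij; rewrite !bE; have := concave_inva i j ij; lra.
have b_nd : forall i j, (1 <= i <= j)%N -> b i <= b j.
  apply: nondecreasing_from1 => k /(frog_left_prob_decreasing model).
  rewrite !p_a lerD2l => ak; rewrite !bE lerD2r ler_pM2l ?divr_gt0//.
  by rewrite ler_pdivrMr// mulrAC ler_pdivlMr// !mul1r.
have rhoE j : (1 <= j)%N -> (1 - p j) / p j = b j / (1 + b j).
  move=> _; have := a_bounds j; rewrite p_a /b => aj.
  by field; rewrite !gt_eqF//=; lra.
have l_gt0 := lambda_gt0 model poisson.
have l_nd := lambda_nondecreasing model poisson.
have -> : (\sum_(1 <= n <oo) (expR (- lambda n * (1 / (4 * a n) - 1 / 2)))%:E =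
    \sum_(1 <= n <oo) (expR (- (lambda n * b n)))%:E)%E.
  by apply: eq_eseriesr => n _; rewrite mulNr.
rewrite -(drift_series_oo l_gt0 (fun j _ => b_gt0 j) concave_lambda b_concave
  l_nd b_nd).
have -> : (\sum_(1 <= n <oo) (expR (- drift_sum lambda b n))%:E =
    \sum_(1 <= n <oo) (barrier_prob p lambda 1 n)%:E)%E.
  by apply: eq_eseriesr => n _; rewrite (barrier_probE _ _ rhoE).
split => [tr|dv]; last first.
  apply: (divergent_transient model poisson); apply/nneseries_oo => //.
  by move=> n; exact: (barrier_prob_ge0 _ model).
apply: contrapT => noo; apply: (convergent_not_transient model poisson _ tr).
by rewrite ltey; apply/negP => /eqP.
Qed.
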